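(* Let $\Phi$ be a homogeneous Poisson point process on $\mathbb{R}^2$ with intensity $\lambda>0$, let $\boldsymbol{x}_{\rm s},\boldsymbol{x}_{\rm d}\in\mathbb{R}^2$ be at distance $2d$ with $d>0$, let $\mathsf{SNR}>0$, let $\rho>0$ be a target rate, and let $G$ be a non-negative non-increasing path-loss function decaying to zero. Consider the threshold-based selective feedback distributed relay selection policy $\mathcal{P}_{\rm FB}$ with threshold value $T\ge d$, and let $\mathsf{P}_{\rm out}(\mathcal{P}_{\rm FB},T)=\mathsf{Pr}\{\mathsf{R}_\Phi(\mathcal{P}_{\rm FB},T)\le\rho\}$ be its outage probability, where $\mathsf{R}_\Phi(\mathcal{P}_{\rm FB},T)$, $\mu(T)$ and $F_{S_{\rm opt}}$ are defined in the context. (i) If there is no fading, then $$\mathsf{P}_{\rm out}(\mathcal{P}_{\rm FB},T)=\begin{cases}e^{-\mu(T)} & \text{if }\rho\le\frac12\log_2(1+\mathsf{SNR}\cdot G(T)),\\ F_{S_{\rm opt}}(2^{2\rho}-1) & \text{if }\frac12\log_2(1+\mathsf{SNR}\cdot G(T))<\rho<\frac12\log_2(1+\mathsf{SNR}\cdot G(d)),\\ 1 & \text{if }\rho\ge\frac12\log_2(1+\mathsf{SNR}\cdot G(d)).\end{cases}$$ (ii) If there is Rayleigh fading, then $$\mathsf{P}_{\rm out}(\mathcal{P}_{\rm FB},T)=\begin{cases}e^{-\mu(T)} & \text{if }s^\star\le\mathsf{SNR}\cdot G(T),\\ F_{S_{\rm opt}}(s^\star) & \text{if }\mathsf{SNR}\cdot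 G(T)<s^\star<\mathsf{SNR}\cdot G(d),\\ 1 & \text{if }s^\star\ge\mathsf{SNR}\cdot G(d),\end{cases}$$ where $s^\star$ is the unique solution of the equation $\frac{1}{2\ln 2}e^{1/s}\,{\rm E}_1(1/s)=\rho$.
   Context: $\boldsymbol{x}_{\rm s}$, $\boldsymbol{x}_{\rm d}$ are the source and destination locations; the points of $\Phi$ are relay locations. Let $\widehat{s}(\boldsymbol{x})=\max\{\|\boldsymbol{x}_{\rm s}-\boldsymbol{x}\|,\|\boldsymbol{x}-\boldsymbol{x}_{\rm d}\|\}$, where $\|\cdot\|$ is the Euclidean norm. Path loss: $G:[0,\infty)\to[0,\infty]$ is non-increasing, finite on $(0,\infty)$, with $G(x)\to 0$ as $x\to\infty$. Its generalized inverse is $G^{-1}(s)=\inf\{x\ge 0: G(x)\le s\}$. Fading: $H_{\rm s,r}$ (source-to-relay) and $H_{\rm r,d}$ (relay-to-destination) are identically distributed complex random variables with the distribution of a generic variable $H$, independent of $\Phi$. ''No fading'' means $|H|^2=1$ deterministically. ''Rayleigh fading'' means $H\sim\mathcal{CN}(0,1)$, i.e. $|H|^2$ is exponential with unit mean. Policy $\mathcal{P}_{\rm FB}$ with threshold $T$: a relay at $\boldsymbol{X}\in\Phi$ feeds back $\widehat{s}(\boldsymbol{X})$ to the source if and only if $\widehat{s}(\boldsymbol{X})\le T$. If at least one relay feeds back, the source selects, among those feeding back, a relay minimizing $\widehat{s}$, and, writing $\boldsymbol{X}^\star$ for the location of that relay, the rate given $\Phi$, averaged over fading only, is $$\mathsf{R}_\Phi(\mathcal{P}_{\rm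 FB},T)=\frac12\min\left\{\mathsf{E}\left[\log_2(1+\mathsf{SNR}|H_{\rm s,r}|^2G(\|\boldsymbol{x}_{\rm s}-\boldsymbol{X}^\star\|))\,\big|\,\Phi\right],\ \mathsf{E}\left[\log_2(1+\mathsf{SNR}|H_{\rm r,d}|^2G(\|\boldsymbol{X}^\star-\boldsymbol{x}_{\rm d}\|))\,\big|\,\Phi\right]\right\}.$$ If no relay feeds back, the source does not transmit and $\mathsf{R}_\Phi(\mathcal{P}_{\rm FB},T)=0$. $\mu(T)$ is the mean number of relays feeding back; for $T\ge d$, $\mu(T)=\lambda\pi T^2-2d\lambda\sqrt{T^2-d^2}-2T^2\lambda\arctan\left(\frac{d}{\sqrt{T^2-d^2}}\right)$ (with the arctangent read as $\pi/2$ when $T=d$). $F_{S_{\rm opt}}$ is the cumulative distribution function of $S_{\rm opt}=\mathsf{SNR}\cdot G(\Gamma_{\rm opt})$, $\Gamma_{\rm opt}=\min_{\boldsymbol{X}\in\Phi}\widehat{s}(\boldsymbol{X})$, given by $F_{S_{\rm opt}}(s)=1-F_{\Gamma_{\rm opt}}\left(G^{-1}\left(\frac{s}{\mathsf{SNR}}\right)\right)$, where $F_{\Gamma_{\rm opt}}(\gamma)=0$ for $\gamma<d$ and $F_{\Gamma_{\rm opt}}(\gamma)=1-\exp\left(-2\lambda d^2\left(\left(\frac{\gamma}{d}\right)^2\operatorname{arcsec}\left(\frac{\gamma}{d}\right)-\sqrt{\left(\frac{\gamma}{d}\right)^2-1}\right)\right)$ for $\gamma\ge d$, with $\operatorname{arcsec}(u)=\arccos(1/u)$.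 ${\rm E}_1(x)=\int_1^\infty\frac{e^{-tx}}{t}\,dt$ for $x>0$.
   Formalization: In the first case of (i) and (ii), when equality holds (ρ=½log₂(1+SNR·G(T)), resp. s*=SNR·G(T)), it is additionally assumed that G(x)>G(T) for all d≤x<T; if G is flat just before T, the stated value e^{-μ(T)} is false there. *)

(* Defs.v *)
From HB Require Import structures.
From mathcomp Require Import all_boot all_order all_algebra.
From mathcomp Require Import all_classical all_reals all_analysis.
From mathcomp Require Import measurable_realfun.

Set Implicit Arguments.
Unset Strict Implicit.
Unset Printing Implicit Defensive.

Import Order.TTheory GRing.Theory Num.Theory.
Import numFieldNormedType.Exports.

Local Open Scope classical_set_scope.
Local Open Scope ring_scope.

(* [R * R] with its product Borel sigma-algebra; used for locations and, via
   z = z.1 + i z.2, for complex fading coefficients. *)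
Definition plane (R : realType) := (measurableTypeR R * measurableTypeR R)%type.

Definition area (R : realType) : set (plane R) -> \bar R :=
  (@lebesgue_measure R \x @lebesgue_measure R)%E.

(* The library norm on a product is the max norm, hence this definition. *)
Definition eucl_dist (R : realType) (x y : plane R) : R :=
  Num.sqrt ((x.1 - y.1) ^+ 2 + (x.2 - y.2) ^+ 2).

Definition sqmod (R : realType) (z : plane R) : R := z.1 ^+ 2 + z.2 ^+ 2.

Definition bounded_region (R : realType) (B : set (plane R)) : Prop :=
  exists r : R, forall x, B x -> eucl_dist (0, 0) x <= r.

Definition shat (R : realType) (xs xd x : plane R) : R :=
  Num.max (eucl_dist xs x) (eucl_dist x xd).

Section point_process.
Context (disp : measure_display) (Omega : measurableType disp) (R : realType).
Variables (P : probability Omega R) (Phi : Omega -> set (plane R)).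

Definition pp_count (B : set (plane R)) (w : Omega) : \bar R :=
  counting (Phi w `&` B).

(* [poisson_pmf] of the library is not used: it is 1 at every k when the rate
   is 0, whereas here an empty region has count 0 almost surely. *)
Definition poisson_process (lambda : R) : Prop :=
  [/\ forall w B, bounded_region B -> finite_set (Phi w `&` B),
      forall B, measurable B -> measurable_fun setT (pp_count B),
      forall B (k : nat), measurable B -> bounded_region B ->
        let m := lambda * fine (area B) in
        P [set w | pp_count B w = k%:R%:E] = (expR (- m) * m ^+ k / k`!%:R)%:E &
      forall n (B : 'I_n -> set (plane R)) (k : 'I_n -> nat),
        (forall i, measurable (B i) /\ bounded_region (B i)) ->
        (forall i j, i != j -> B i `&` B j = set0) ->
        P [set w | forall i, pp_count (B i) w = (k i)%:R%:E] =
        (\prod_(i < n) P [set w | pp_count (B i) w = (k i)%:R%:E])%E].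

(* sigma(Phi) *)
Definition sigma_pp : set_system Omega :=
  <<s [set A | exists B k,
         measurable B /\ A = [set w | pp_count B w = (k : nat)%:R%:E] ] >>.

Definition pp_measurable d' (T' : measurableType d') (f : Omega -> T') : Prop :=
  forall B, measurable B -> sigma_pp (f @^-1` B).

Definition pp_independent d' (T' : measurableType d') (X : Omega -> T') : Prop :=
  forall A B, sigma_pp A -> measurable B ->
    P (A `&` X @^-1` B) = (P A * P (X @^-1` B))%E.

(* [Z] is a version of E[Y | Phi], for [Y] with values in [0, +oo]. *)
Definition pp_cond_exp (Y Z : Omega -> \bar R) : Prop :=
  [/\ forall w, (0 <= Z w)%E,
      pp_measurable Z &
      forall A, sigma_pp A ->
        (\int[P]_(w in A) Z w = \int[P]_(w in A) Y w)%E].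

End point_process.

Section fading.
Context (R : realType).

Definition no_fading (nu : probability (plane R) R) : Prop :=
  nu [set z | sqmod z = 1] = 1%E.

(* CN(0,1): independent real and imaginary parts, each centred normal of
   variance 1/2. *)
Definition rayleigh_fading (nu : probability (plane R) R) : Prop :=
  let N := normal_prob (0 : R) (Num.sqrt 2^-1) in
  forall A, measurable A -> nu A = (N \x N)%E A.

End fading.

Section path_loss.
Context (R : realType).

(* Only the values of [G] on [0, +oo[ matter. *)
Definition path_loss (G : R -> \bar R) : Prop :=
  [/\ forall x, 0 <= x -> (0 <= G x)%E,
      forall x y, 0 <= x -> x <= y -> (G y <= G x)%E,
      forall x, 0 < x -> (G x < +oo)%E &
      G x @[x --> +oo] --> 0%E].

(* For s > 0 the set is nonempty, as G tends to 0. *)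
Definition ginv (G : R -> \bar R) (s : R) : R :=
  inf [set x | 0 <= x /\ (G x <= s%:E)%E].

Definition log2e (x : \bar R) : \bar R := (lne x * ((ln 2)^-1)%:E)%E.

End path_loss.

Section policy.
Context (disp : measure_display) (Omega : measurableType disp) (R : realType).
Variables (P : probability Omega R) (Phi : Omega -> set (plane R)).
Variables (xs xd : plane R) (T : R).

Definition feedback (w : Omega) : set (plane R) :=
  [set x | Phi w x /\ shat xs xd x <= T].

(* [Xstar] is arbitrary when no relay feeds back. *)
Definition fb_selection (Xstar : Omega -> plane R) : Prop :=
  pp_measurable Phi Xstar /\
  forall w, feedback w !=set0 ->
    feedback w (Xstar w) /\
    forall y, feedback w y -> shat xs xd (Xstar w) <= shat xs xd y.

(* [rate] is a version of R_Phi(P_FB, T); the convention 0 * +oo = 0 applies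
   when H = 0 and the selected relay is at a distance where G is +oo. *)
Definition fb_rate (SNR : R) (G : R -> \bar R) (Hsr Hrd : Omega -> plane R)
    (Xstar : Omega -> plane R) (rate : Omega -> \bar R) : Prop :=
  exists Zsr Zrd : Omega -> \bar R,
  [/\ pp_cond_exp P Phi
        (fun w => log2e (1 + (SNR * sqmod (Hsr w))%:E * G (eucl_dist xs (Xstar w)))%E)
        Zsr,
      pp_cond_exp P Phi
        (fun w => log2e (1 + (SNR * sqmod (Hrd w))%:E * G (eucl_dist (Xstar w) xd))%E)
        Zrd &
      forall w, rate w =
        if `[< feedback w !=set0 >] then (2^-1%:E * mine (Zsr w) (Zrd w))%E
        else 0%E].

Definition outage (rate : Omega -> \bar R) (rho : R) : \bar R :=
  P [set w | (rate w <= rho%:E)%E].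

End policy.

Section closed_forms.
Context (R : realType).
Variables (d lambda : R).

(* lambda times the area of the intersection of the two discs of radius T
   centred at the source and at the destination, at distance 2d, for T >= d. *)
Definition mu_fb (T : R) : R :=
  let r := Num.sqrt (T ^+ 2 - d ^+ 2) in
  lambda * pi * T ^+ 2 - 2 * d * lambda * r
  - 2 * T ^+ 2 * lambda * (if T == d then pi / 2 else atan (d / r)).

Definition arcsec (u : R) : R := acos u^-1.

Definition F_Gamma_opt (g : R) : R :=
  if g < d then 0 else
  1 - expR (- (2 * lambda * d ^+ 2 *
    ((g / d) ^+ 2 * arcsec (g / d) - Num.sqrt ((g / d) ^+ 2 - 1)))).

Definition F_S_opt (SNR : R) (G : R -> \bar R) (s : R) : R :=
  1 - F_Gamma_opt (ginv G (s / SNR)).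

End closed_forms.

Definition E1 (R : realType) (x : R) : R :=
  \int[@lebesgue_measure R]_(t in `[1, +oo[) (expR (- (t * x)) / t).

(* The equation determining the SNR at which the ergodic rate equals rho. *)
Definition ergodic_snr (R : realType) (rho s : R) : Prop :=
  0 < s /\ (2 * ln 2)^-1 * expR (1 / s) * E1 (1 / s) = rho.

(* Main.v *)
(* Since the fading is independent of Phi, freezing the selected relay X*
   turns the rate given Phi into half the minimum of two values of the function
   ergodic_rate x = E[log2(1 + |H|^2 x)], which by monotonicity is its value at
   SNR * G(shat X* ). Writing s for the SNR at which half the ergodic rate is rho,
   strict monotonicity makes outage the event SNR * G(min shat) <= s: up to a
   null event, no relay lies in a lens [shat <= g], where g is T or the
   generalized inverse of G at s / SNR. The Poisson void probability then leaves
   only the area of a lens to compute. A rotation, written as three shears, aligns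
   the lens with an axis, and its slices are integrated.

   Under Rayleigh fading the area pi r^2 of a disc says that sqmod pushes the
   plane's area to pi times Lebesgue measure, so |H|^2 is exponential; the tail
   formula for E[ln(1 + |H|^2 s)] and the substitution t = e^r give
   e^(1/s) E1(1/s). Existence of s is the intermediate value theorem, based on
   h(y) - h(x) <= log2(y / x) and h(y) - h(x) >= e^-1 log2((1 + y) / (1 + x))
   for x <= y, where h is the ergodic rate. *)
Require Import Defs.
From HB Require Import structures.
From mathcomp Require Import all_boot all_order all_algebra.
From mathcomp Require Import all_classical all_reals all_analysis.
From mathcomp Require Import measurable_realfun.
From mathcomp Require Import ring lra.

Set Implicit Arguments.
Unset Strict Implicit.
Unset Printing Implicit Defensive.

Import Order.TTheory GRing.Theory Num.Theory.
Import numFieldNormedType.Exports.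

Local Open Scope classical_set_scope.
Local Open Scope ring_scope.

(** * Planar area and the lens of two discs *)

Section planar_area.
Context {R : realType}.
Implicit Types (A : set (plane R)) (a b c d : R).
Local Notation mu := (@lebesgue_measure R).

(** A translation keeps the length of half-open intervals, and these determine Lebesgue measure. *)
Lemma lebesgue_measureD (a : R) (A : set (measurableTypeR R)) : measurable A ->
  mu ((fun y => y + a) @^-1` A) = mu A.
Proof.
move=> mA; have mD : @measurable_fun _ _ (measurableTypeR R) (measurableTypeR R) setT
  (fun y => y + a) by exact: measurable_funD.
pose f : {mfun measurableTypeR R >-> measurableTypeR R} :=
  @mfun_Sub _ _ (measurableTypeR R) (measurableTypeR R) _ (mem_set mD).
rewrite [RHS](@lebesgue_measure_unique _ (pushforward mu f))//.
move=> _ [[u v]] _ <-; transitivity (mu `]u - a, v - a]); last first.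
  by congr (mu _); apply/seteqP; split => x /=; rewrite !in_itv/= ltrBlDr lerBrDr.
by rewrite /= !lebesgue_measure_itv/= !lte_fin ltrD2r -!EFinB opprB addrA subrK.
Qed.

(** Cavalieri: each vertical slice is only translated, by an amount depending on the slice. *)
Lemma area_shear_snd (f : R -> R) A : measurable_fun setT f -> measurable A ->
  area ((fun p => (p.1, p.2 + f p.1)) @^-1` A) = area A.
Proof.
move=> mf mA; apply: eq_integral => x _.
have := lebesgue_measureD (f x) (measurable_xsection x mA) => /= <-.
by congr (mu _); apply/seteqP; split => y; rewrite /xsection/= !inE.
Qed.

Lemma area_swap A : measurable A -> area ((fun p => (p.2, p.1)) @^-1` A) = area A.
Proof.
move=> mA.
have mS : measurable_fun [set: plane R] (fun p : plane R => (p.2, p.1) : plane R).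
  by apply: measurable_fun_pair; [exact: measurable_snd|exact: measurable_fst].
pose f : {mfun plane R >-> plane R} := mfun_Sub (mem_set mS).
rewrite [RHS](@product_measure_unique _ _ _ _ _ _ _ (pushforward (mu \x mu)%E f))//.
move=> B C mB mC; transitivity ((mu \x mu)%E (C `*` B)).
  by congr ((mu \x mu)%E _); apply/seteqP; split => -[x y] /= [].
by rewrite product_measure1E// muleC.
Qed.

Lemma measurable_shear_fst (f : R -> R) A : measurable_fun setT f ->
  measurable A -> measurable ((fun p : plane R => (p.1 + f p.2, p.2)) @^-1` A).
Proof.
move=> mf mA; rewrite -[X in measurable X]setTI.
have mp : measurable_fun [set: plane R] (fun p : plane R => (p.1 + f p.2, p.2) : plane R).
  apply: measurable_fun_pair; last exact: measurable_snd.
  by apply: measurable_funD => //; exact: measurableT_comp.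
exact: mp.
Qed.

Lemma measurable_shear_snd (f : R -> R) A : measurable_fun setT f ->
  measurable A -> measurable ((fun p : plane R => (p.1, p.2 + f p.1)) @^-1` A).
Proof.
move=> mf mA; rewrite -[X in measurable X]setTI.
have mp : measurable_fun [set: plane R] (fun p : plane R => (p.1, p.2 + f p.1) : plane R).
  apply: measurable_fun_pair; first exact: measurable_fst.
  by apply: measurable_funD => //; exact: measurableT_comp.
exact: mp.
Qed.

(** Conjugation by the swap of coordinates exchanges the two kinds of shear. *)
Lemma area_shear_fst (f : R -> R) A : measurable_fun setT f -> measurable A ->
  area ((fun p => (p.1 + f p.2, p.2)) @^-1` A) = area A.
Proof.
move=> mf mA.
have mS : measurable_fun [set: plane R] (fun p : plane R => (p.2, p.1) : plane R).
  by apply: measurable_fun_pair; [exact: measurable_snd|exact: measurable_fst].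
have mSA : measurable ((fun p => (p.2, p.1)) @^-1` A).
  by rewrite -[X in measurable X]setTI; exact: mS.
rewrite -[RHS](area_swap mA) -[RHS](area_shear_snd mf mSA) -[RHS]area_swap//.
exact: measurable_shear_snd.
Qed.

Definition rotation (c s : R) (p : plane R) : plane R :=
  (c * p.1 - s * p.2, s * p.1 + c * p.2).

(* A rotation of angle a is the composition of two horizontal shears of factor
   - tan (a / 2) around a vertical shear of factor sin a. *)
Lemma area_rotation (c s : R) A : c ^+ 2 + s ^+ 2 = 1 -> c != -1 ->
  measurable A -> area (rotation c s @^-1` A) = area A.
Proof.
move=> cs c1 mA; have c10 : 1 + c != 0 by rewrite addrC addr_eq0.
(* With c = cos a and s = sin a this is tan (a / 2), which a half-turn does not have; hence
   [c != -1]. *)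
set t := s / (1 + c).
have mM k : measurable_fun setT (fun x : R => k * x) by exact: measurable_funM.
rewrite -[RHS](area_shear_fst (mM (- t)) mA).
have m1 := measurable_shear_fst (mM (- t)) mA.
rewrite -[RHS](area_shear_snd (mM s) m1).
rewrite -[RHS](area_shear_fst (mM (- t)) (measurable_shear_snd (mM s) m1)).
have tc : t * (1 + c) = s by rewrite /t divfK.
have st : s * t = 1 - c by apply: (mulIf c10); rewrite -mulrA tc -expr2; nra.
have rotE x y : x + - t * y + - t * (y + s * (x + - t * y)) = c * x - s * y.
  transitivity (x - t * y * 2 - s * t * x + s * t * (t * y)); first by ring.
  by rewrite st -tc; ring.
have rotE' x y : y + s * (x + - t * y) = s * x + c * y.
  by transitivity (y + s * x - s * t * y); [ring|rewrite st; ring].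
by congr (area _); apply/seteqP; split=> -[x y] /=; rewrite /rotation/= rotE rotE'.
Qed.

(** * Alignment of the lens with an axis, and its slices *)

Lemma eucl_distC (p q : plane R) : eucl_dist p q = eucl_dist q p.
Proof. by rewrite /eucl_dist -sqrrN opprB -[X in _ + X]sqrrN opprB. Qed.

Lemma shatC (p q x : plane R) : shat p q x = shat q p x.
Proof. by rewrite /shat eucl_distC maxC eucl_distC. Qed.

Lemma measurable_eucl_dist (q : plane R) : measurable_fun [set: plane R] (eucl_dist q).
Proof.
apply: (@measurableT_comp _ _ _ _ _ _ (@Num.sqrt R)).
  by apply: continuous_measurable_fun; exact: sqrt_continuous.
by apply: measurable_funD; apply: measurable_funX; apply: measurable_funB => //.
Qed.

Lemma measurable_shat (p q : plane R) : measurable_fun [set: plane R] (shat p q).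
Proof.
apply: measurable_maxr; first exact: measurable_eucl_dist.
under eq_fun do rewrite eucl_distC; exact: measurable_eucl_dist.
Qed.

(** A rigid motion moves the two endpoints to the second axis, symmetrically about the origin; it
    preserves area and, by [E1] and [E2], both distances. *)
Lemma area_shat_aligned xs xd d (B : set R) : 0 < d -> measurable B ->
  eucl_dist xs xd = 2 * d ->
  area (shat xs xd @^-1` B) = area (shat (0, - d) (0, d) @^-1` B).
Proof.
(* The excluded case would call for a half-turn; exchanging the endpoints leaves [shat] unchanged
   and avoids it. *)
move=> d0 mB; wlog : xs xd / xd.2 - xs.2 != - (2 * d).
  move=> wlg ds; have [e|ne] := eqVneq (xd.2 - xs.2) (- (2 * d)); last exact: wlg.
  rewrite -(wlg xd xs); [|by lra|by rewrite eucl_distC].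
  by have -> : shat xs xd = shat xd xs by apply/funext => x; exact: shatC.
move=> ne ds.
have ds2 : (xs.1 - xd.1) ^+ 2 + (xs.2 - xd.2) ^+ 2 = (2 * d) ^+ 2.
  by rewrite -ds sqr_sqrtr// addr_ge0// sqr_ge0.
(* Cosine and sine of the rotation sending (0, 2 d) to the vector from [xs] to [xd]. *)
set c := (xd.2 - xs.2) / (2 * d); set s := - ((xd.1 - xs.1) / (2 * d)).
have d20 : 2 * d != 0 by rewrite mulf_neq0 ?gt_eqF.
have hc : xd.2 - xs.2 = c * (2 * d) by rewrite divfK.
have hs : xd.1 - xs.1 = - s * (2 * d) by rewrite opprK divfK.
have cs : c ^+ 2 + s ^+ 2 = 1.
  apply: (mulIf (expf_neq0 2 d20)); transitivity ((xd.2 - xs.2) ^+ 2 + (xd.1 - xs.1) ^+ 2).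
    by rewrite hc hs; ring.
  by rewrite mul1r -ds2; ring.
have c1 : c != -1.
  by apply: contra ne => /eqP e; rewrite hc e mulN1r.
have mshat : measurable (shat xs xd @^-1` B).
  by rewrite -[X in measurable X]setTI; exact: measurable_shat.
(* A shear by a constant function is a translation; the two used here take the origin to the
   midpoint of the endpoints. *)
have mC (k : R) : measurable_fun setT (fun x : R => k) by exact: measurable_cst.
rewrite -(area_shear_fst (mC ((xs.1 + xd.1) / 2)) mshat).
have m1 := measurable_shear_fst (mC ((xs.1 + xd.1) / 2)) mshat.
rewrite -(area_shear_snd (mC ((xs.2 + xd.2) / 2)) m1).
rewrite -(area_rotation cs c1 (measurable_shear_snd (mC ((xs.2 + xd.2) / 2)) m1)).
have E1 x y : eucl_dist xs (c * x - s * y + (xs.1 + xd.1) / 2,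
    s * x + c * y + (xs.2 + xd.2) / 2) = eucl_dist (0, - d) (x, y).
  rewrite /eucl_dist/=; congr Num.sqrt.
  transitivity ((c ^+ 2 + s ^+ 2) * (x ^+ 2 + (d + y) ^+ 2)); last by rewrite cs; ring.
  have -> : xs.1 - (c * x - s * y + (xs.1 + xd.1) / 2) = s * d - c * x + s * y by lra.
  have -> : xs.2 - (s * x + c * y + (xs.2 + xd.2) / 2) = - c * d - s * x - c * y by lra.
  by ring.
have E2 x y : eucl_dist (c * x - s * y + (xs.1 + xd.1) / 2,
    s * x + c * y + (xs.2 + xd.2) / 2) xd = eucl_dist (x, y) (0, d).
  rewrite /eucl_dist/=; congr Num.sqrt.
  transitivity ((c ^+ 2 + s ^+ 2) * (x ^+ 2 + (y - d) ^+ 2)); last by rewrite cs; ring.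
  have -> : (c * x - s * y + (xs.1 + xd.1) / 2) - xd.1 = c * x - s * y + s * d by lra.
  have -> : (s * x + c * y + (xs.2 + xd.2) / 2) - xd.2 = s * x + c * y - c * d by lra.
  by ring.
congr (area _); apply/seteqP.
by split=> -[x y] /=; rewrite /rotation/= /shat E1 E2.
Qed.

(** The farther of the two centres is the one across the horizontal axis, at vertical distance |y| +
    d. *)
Lemma xsection_shat d t x : 0 < d -> 0 <= t ->
  xsection (shat (0, - d) (0, d) @^-1` [set u | u <= t]) x =
  [set y | x ^+ 2 + (`|y| + d) ^+ 2 <= t ^+ 2].
Proof.
move=> d0 t0; apply/seteqP; split => y; rewrite /xsection/= inE/= /shat/eucl_dist/= ge_max.
  rewrite -!(ler_sqr _ t0) ?nnegrE ?sqrtr_ge0// !sqr_sqrtr ?addr_ge0 ?sqr_ge0//.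
  by have [] := ger0P y; nra.
rewrite -!(@ler_sqr _ _ t) ?nnegrE ?sqrtr_ge0// !sqr_sqrtr ?addr_ge0 ?sqr_ge0//.
have [] := ger0P y; nra.
Qed.

(* [2 * atan (x / (t + sqrt (t^2 - x^2)))] is [asin (x / t)]; in this form the
   antiderivative is visibly continuous at the endpoints [x = t] and [x = - t]. *)
Definition disc_prim t (x : R) : R := x * Num.sqrt (t ^+ 2 - x ^+ 2) +
  2 * t ^+ 2 * atan (x / (t + Num.sqrt (t ^+ 2 - x ^+ 2))).

Lemma is_derive_disc_prim (t x : R) : - t < x < t ->
  is_derive x 1 (disc_prim t) (2 * Num.sqrt (t ^+ 2 - x ^+ 2)).
Proof.
move=> /andP[x1 x2]; have t0 : 0 < t by lra.
have tx : 0 < t ^+ 2 - x ^+ 2 by rewrite subr_sqr mulr_gt0//; lra.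
set S := Num.sqrt (t ^+ 2 - x ^+ 2).
have S0 : 0 < S by rewrite sqrtr_gt0.
have SS : S ^+ 2 = t ^+ 2 - x ^+ 2 by rewrite sqr_sqrtr// ltW.
have tS0 : 0 < t + S by rewrite addr_gt0.
have dS : is_derive x 1 (fun x => Num.sqrt (t ^+ 2 - x ^+ 2)) (- x / S).
  have dq : is_derive x (1 : R) (fun x => t ^+ 2 - x ^+ 2) (- (2 * x)).
    apply: is_derive_eq; rewrite /GRing.scale/=; ring.
  apply: (is_derive_eq (@is_derive1_comp _ Num.sqrt _ x _ _ (is_derive1_sqrt tx) dq)).
  by rewrite -/S; field; rewrite gt_eqF.
have dtS : is_derive x 1 (fun x => t + Num.sqrt (t ^+ 2 - x ^+ 2)) (- x / S).
  by apply: (is_derive_eq (is_deriveD (is_derive_cst t x 1) dS)); rewrite add0r.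
have du : is_derive x 1 (fun x => x / (t + Num.sqrt (t ^+ 2 - x ^+ 2)))
    (t / (S * (t + S))).
  apply: (is_derive_eq (is_deriveM (is_derive_id x 1) (is_deriveV _ dtS))) => /=.
    by rewrite gt_eqF.
  rewrite /GRing.scale/= -/S.
  have -> : t / (S * (t + S)) = (S * (t + S) + x ^+ 2) / (S * (t + S) ^+ 2).
    have -> : x ^+ 2 = t ^+ 2 - S ^+ 2 by rewrite SS; ring.
    by field; rewrite !gt_eqF.
  by field; rewrite !gt_eqF.
apply: (is_derive_eq (is_deriveD (is_deriveM (is_derive_id x 1) dS)
  (is_deriveZ (2 * t ^+ 2) (is_derive1_comp (is_derive1_atan _) du)))); rewrite /GRing.scale/= -/S.
(* Since S^2 = t^2 - x^2, (t + S)^2 + x^2 = 2 t (t + S). *)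
have -> : 1 + (x / (t + S)) ^+ 2 = 2 * t / (t + S).
  have -> : 2 * t / (t + S) = ((t + S) ^+ 2 + (t ^+ 2 - S ^+ 2)) / (t + S) ^+ 2.
    by field; rewrite gt_eqF.
  by rewrite SS; field; rewrite gt_eqF.
have -> : x * (- x / S) = - (t ^+ 2 - S ^+ 2) / S by rewrite SS; field; rewrite gt_eqF.
by field; rewrite !gt_eqF.
Qed.

Lemma continuous_disc_prim (t : R) : 0 < t -> continuous (disc_prim t).
Proof.
move=> t0 x.
have cS : {for x, continuous (fun x : R => Num.sqrt (t ^+ 2 - x ^+ 2))}.
  apply: (@continuous_comp _ _ _ (fun x : R => t ^+ 2 - x ^+ 2) (@Num.sqrt R)).
    by apply: cvgB; [exact: cvg_cst|exact: exprn_continuous].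
  exact: sqrt_continuous.
have cu : {for x, continuous (fun x : R => x / (t + Num.sqrt (t ^+ 2 - x ^+ 2)))}.
  apply: cvgM; first exact: cvg_id.
  apply: cvgV; first by rewrite gt_eqF// ltr_wpDr// sqrtr_ge0.
  by apply: cvgD => //; exact: cvg_cst.
have ca : {for x, continuous (fun x : R => atan (x / (t + Num.sqrt (t ^+ 2 - x ^+ 2))))}.
  apply: (@continuous_comp _ _ _ (fun x : R => x / (t + Num.sqrt (t ^+ 2 - x ^+ 2)))
    (@atan R)) => //.
  exact: continuous_atan.
apply: cvgD; first by apply: cvgM => //; exact: cvg_id.
by apply: cvgM => //; exact: cvg_cst.
Qed.

(** When [a = t] the square root is not differentiable at the endpoints, so only continuity of the
    primitive is used there. That case with [k = 0] is the disc; the lens has [k = d] and a^2 = t^2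
    - d^2. *)
Lemma integral_chord (t a k : R) : 0 < a <= t ->
  (\int[mu]_(x in `[(- a)%R, a]) (2 * (Num.sqrt (t ^+ 2 - x ^+ 2) - k))%:E =
   (2 * a * Num.sqrt (t ^+ 2 - a ^+ 2) +
    4 * t ^+ 2 * atan (a / (t + Num.sqrt (t ^+ 2 - a ^+ 2))) - 4 * a * k)%:E)%E.
Proof.
move=> /andP[a0 at_]; have t0 : 0 < t by lra.
rewrite (@continuous_FTC2 _ _ (fun x => disc_prim t x - 2 * k * x)).
- rewrite -EFinB /disc_prim sqrrN !mulNr atanN; congr EFin; ring.
- by lra.
- apply: continuous_subspaceT => x.
  apply: cvgM; first exact: cvg_cst.
  apply: cvgB; last exact: cvg_cst.
  apply: (@continuous_comp _ _ _ (fun x : R => t ^+ 2 - x ^+ 2) (@Num.sqrt R)).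
    by apply: cvgB; [exact: cvg_cst|exact: exprn_continuous].
  exact: sqrt_continuous.
- have cF : continuous (fun x => disc_prim t x - 2 * k * x).
    move=> x; apply: cvgB; first exact: continuous_disc_prim.
    by apply: cvgM; [exact: cvg_cst|exact: cvg_id].
  split.
  + move=> x; rewrite in_itv/= => xa.
    have /is_derive_disc_prim dx : - t < x < t by lra.
    by apply: derivableB; [case: dx|exact: derivableM].
  + by apply: cvg_at_right_filter; exact: cF.
  + by apply: cvg_at_left_filter; exact: cF.
- move=> x; rewrite in_itv/= => xa.
  have /is_derive_disc_prim dx : - t < x < t by lra.
  rewrite derive1E; apply: derive_val.
  apply: (is_derive_eq (is_deriveB dx (is_deriveZ (2 * k) (is_derive_id x 1)))).
  by rewrite /GRing.scale/=; ring.
Qed.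

(** Two circular segments of half-angle [acos (d / t)], each a sector minus a triangle. *)
Definition lens_area d t : R :=
  2 * t ^+ 2 * acos (d / t) - 2 * d * Num.sqrt (t ^+ 2 - d ^+ 2).

(** Half-angle formula: the squared tangent of half the angle is (1 - cos) / (1 + cos) = (t - d) /
    (t + d). It turns the arctangent of [disc_prim] into the arccosine of [lens_area]. *)
Lemma acos_half_angle d t : 0 < d <= t ->
  2 * atan (Num.sqrt (t ^+ 2 - d ^+ 2) / (t + d)) = acos (d / t).
Proof.
move=> /andP[d0 dt]; have t0 : 0 < t by lra.
set u := _ / _; have u0 : 0 <= u by rewrite divr_ge0 ?sqrtr_ge0//; lra.
have uu : u ^+ 2 = (t - d) / (t + d).
  rewrite /u expr_div_n sqr_sqrtr; last by rewrite subr_ge0 ler_sqr ?nnegrE; lra.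
  by field; lra.
have cu : cos (2 * atan u) = d / t.
  rewrite mulr_natl cos_mulr2n cos_atan exprVn sqr_sqrtr; last by rewrite addr_ge0// sqr_ge0.
  rewrite uu; have -> : 1 + (t - d) / (t + d) = 2 * t / (t + d) by field; lra.
  by rewrite -mulr_natl; field; lra.
rewrite -cu cosK// in_itv/=; apply/andP; split.
  by rewrite mulr_ge0// -atan0 le_atan.
by have := atan_ltpi2 u; lra.
Qed.

Lemma lebesgue_measure_slice (d x t : R) : 0 <= d -> d <= t ->
  mu [set y | x ^+ 2 + (`|y| + d) ^+ 2 <= t ^+ 2] =
  (if `|x| <= Num.sqrt (t ^+ 2 - d ^+ 2)
   then (2 * (Num.sqrt (t ^+ 2 - x ^+ 2) - d))%:E else 0%E).
Proof.
move=> d0 dt; have dt2 : 0 <= t ^+ 2 - d ^+ 2 by rewrite subr_ge0 ler_sqr ?nnegrE; lra.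
have xE : (`|x| <= Num.sqrt (t ^+ 2 - d ^+ 2)) = (d ^+ 2 <= t ^+ 2 - x ^+ 2).
  rewrite -(@ler_sqr _ `|x|) ?nnegrE ?sqrtr_ge0// sqr_sqrtr// real_normK ?num_real//.
  by rewrite !lerBrDr addrC.
rewrite xE; case: ifPn => [xd|]; last first.
  rewrite -ltNge => xd; rewrite (_ : [set _ | _] = set0) ?measure0//.
  apply/seteqP; split => y //=; have := normr_ge0 y; set z := `|y|; nra.
have tx0 : 0 <= t ^+ 2 - x ^+ 2 by apply: le_trans xd; rewrite sqr_ge0.
set S := Num.sqrt (t ^+ 2 - x ^+ 2).
have SS : S ^+ 2 = t ^+ 2 - x ^+ 2 by rewrite sqr_sqrtr.
have dS : d <= S by rewrite -(@ler_sqr _ d) ?nnegrE ?sqrtr_ge0 ?SS// ltW.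
rewrite (_ : [set _ | _] = `[- (S - d), S - d]%classic); last first.
  apply/seteqP; split => y /=; rewrite in_itv/= -ler_norml; have := normr_ge0 y.
    move=> y0 h; rewrite lerBrDr -(@ler_sqr _ _ S) ?nnegrE; lra.
  by move=> y0; rewrite lerBrDr -(@ler_sqr _ _ S) ?nnegrE; lra.
rewrite lebesgue_measure_itv/= lte_fin; case: ifPn => [_|].
  by rewrite -EFinD; congr EFin; lra.
by rewrite -leNgt => h; congr EFin; lra.
Qed.

Lemma lens_areaE d t : 0 < d -> d <= t ->
  area (shat (0, - d) (0, d) @^-1` [set u | u <= t]) = (lens_area d t)%:E.
Proof.
move=> d0 dt; have dt2 : 0 <= t ^+ 2 - d ^+ 2 by rewrite subr_ge0 ler_sqr ?nnegrE; lra.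
set r := Num.sqrt (t ^+ 2 - d ^+ 2).
transitivity (\int[mu]_(x in `[(- r)%R, r]) (2 * (Num.sqrt (t ^+ 2 - x ^+ 2) - d))%:E)%E.
  rewrite [RHS]integral_mkcond; apply: eq_integral => x _ /=.
  rewrite xsection_shat//; last by lra.
  by rewrite (lebesgue_measure_slice x (ltW d0) dt) patchE mem_setE in_itv/= -ler_norml.
have rr : r ^+ 2 = t ^+ 2 - d ^+ 2 by rewrite sqr_sqrtr.
(* [integral_chord] wants a positive half-width; [r = 0] means [t = d], tangent discs and zero
   area. *)
have := sqrtr_ge0 (t ^+ 2 - d ^+ 2); rewrite -/r le_eqVlt => /predU1P[r0|r0].
  rewrite /lens_area -/r -r0 oppr0 set_itv1 integral_set1.
  have td : t <= d.
    rewrite leNgt; apply/negP => dlt; have : 0 < (t - d) * (t + d) by rewrite mulr_gt0; lra.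
    by rewrite -subr_sqr -rr -r0 expr0n ltxx.
  have -> : d = t by lra.
  by rewrite divff ?gt_eqF//; [rewrite acos1 !mulr0 subr0|lra].
rewrite integral_chord; last first.
  by rewrite r0/= -(@ler_sqr _ r) ?nnegrE; [nra|lra|lra].
have -> : t ^+ 2 - r ^+ 2 = d ^+ 2 by rewrite rr; ring.
rewrite sqrtr_sqr gtr0_norm// /lens_area -/r -acos_half_angle ?d0// -/r.
by congr EFin; ring.
Qed.

(** Each vertical slice of the level set has at most two points. This is what makes the open and the
    closed lens interchangeable. *)
Lemma area_shat_eq0 d t : 0 < d -> d <= t ->
  area (shat (0, - d) (0, d) @^-1` [set t]) = 0%E.
Proof.
move=> d0 dt; apply: integral0_eq => x _ /=.
set S := Num.sqrt (t ^+ 2 - x ^+ 2).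
apply: (@subset_measure0 _ _ _ mu _ [set S - d; - (S - d)]) => //=.
- apply: measurable_xsection; rewrite -[X in measurable X]setTI.
  by apply: measurable_shat.
- by apply: measurableU; exact: measurable_set1.
- move=> y; rewrite /xsection/= inE/= => st.
  have t0 : 0 <= t by lra.
  have : x ^+ 2 + (`|y| + d) ^+ 2 = t ^+ 2.
    have : xsection (shat (0, - d) (0, d) @^-1` [set u | u <= t]) x y.
      by rewrite /xsection/= inE/= st.
    rewrite xsection_shat//= => h; apply/eqP; rewrite eq_le h/= leNgt; apply/negP => h'.
    have : shat (0, - d) (0, d) (x, y) < t.
      rewrite /shat /eucl_dist/= gt_max -!(@ltr_sqr _ _ t) ?nnegrE ?sqrtr_ge0//.
      rewrite !sqr_sqrtr ?addr_ge0 ?sqr_ge0//.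
      by move: h'; case: (ger0P y) => y0 h'; apply/andP; split; nra.
    by rewrite st ltxx.
  move=> e; have eS : `|y| = S - d.
    have -> : S = `|y| + d.
      by rewrite /S -e addrC addKr sqrtr_sqr ger0_norm// addr_ge0// ltW.
    by rewrite addrK.
  by rewrite /= -eS; case: (ger0P y) => _; [left|right; rewrite opprK].
- by rewrite measureU0//; exact: lebesgue_measure_set1.
Qed.

Lemma measurable_le_set (t : R) : measurable [set u : R | u <= t].
Proof. by rewrite -[X in measurable X]/([set` `]-oo, t]]); exact: measurable_itv. Qed.

Lemma measurable_lt_set (t : R) : measurable [set u : R | u < t].
Proof. by rewrite -[X in measurable X]/([set` `]-oo, t[]); exact: measurable_itv. Qed.

Lemma area_lens xs xd d t : 0 < d -> d <= t -> eucl_dist xs xd = 2 * d ->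
  area (shat xs xd @^-1` [set u | u <= t]) = (lens_area d t)%:E.
Proof.
move=> d0 dt ds; rewrite (area_shat_aligned d0 _ ds) ?lens_areaE//.
exact: measurable_le_set.
Qed.

Lemma area_open_lens xs xd d t : 0 < d -> d <= t -> eucl_dist xs xd = 2 * d ->
  area (shat xs xd @^-1` [set u | u < t]) = (lens_area d t)%:E.
Proof.
move=> d0 dt ds; rewrite -(area_lens d0 dt ds).
have mS (B : set R) : measurable B -> measurable (shat xs xd @^-1` B).
  by move=> mB; rewrite -[X in measurable X]setTI; exact: measurable_shat.
have mlt := measurable_lt_set t.
have -> : shat xs xd @^-1` [set u | u <= t] =
    shat xs xd @^-1` [set u | u < t] `|` shat xs xd @^-1` [set t].
  apply/seteqP; split => x /=; rewrite le_eqVlt.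
    by move=> /predU1P; tauto.
  by move=> [->|->]; rewrite ?eqxx ?orbT.
rewrite [RHS]measureU0//; [exact: mS|exact: mS|].
by rewrite -[LHS]/(area (shat xs xd @^-1` [set t])) (area_shat_aligned d0 _ ds) ?area_shat_eq0.
Qed.

(** * The closed forms [mu_fb] and [F_Gamma_opt] in terms of the lens area *)

Lemma acos_atan d t : 0 < d < t -> acos (d / t) = pi / 2 - atan (d / Num.sqrt (t ^+ 2 - d ^+ 2)).
Proof.
move=> /andP[d0 dt]; have t0 : 0 < t by lra.
have dt2 : 0 < t ^+ 2 - d ^+ 2 by rewrite subr_gt0 ltr_sqr ?nnegrE; lra.
set r := Num.sqrt _; have r0 : 0 < r by rewrite sqrtr_gt0.
have rr : r ^+ 2 = t ^+ 2 - d ^+ 2 by rewrite sqr_sqrtr// ltW.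
have u01 : 0 < d / t < 1 by rewrite divr_gt0//= ltr_pdivrMr ?mul1r.
(* [d / r] is the cotangent of [acos (d / t)], the tangent of the complementary angle. *)
have -> : d / r = tan (pi / 2 - acos (d / t)).
  rewrite /tan sinB cosB cos_pihalf sin_pihalf !mul0r !mul1r subr0 add0r.
  rewrite acosK ?in_itv/=; last by lra.
  rewrite sin_acos; last by lra.
  have -> : 1 - (d / t) ^+ 2 = (r / t) ^+ 2 by rewrite !expr_div_n rr; field; lra.
  by rewrite sqrtr_sqr ger0_norm ?divr_ge0 1?ltW//; field; lra.
rewrite tanK; first by lra.
have := acos_gt0 (_ : -1 <= d / t < 1); have := acos_ltpi (_ : -1 < d / t <= 1).
rewrite in_itv/= => /(_ ltac:(lra)) h1 /(_ ltac:(lra)) h2.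
by lra.
Qed.

Lemma mu_fbE d lambda t : 0 < d -> d <= t -> mu_fb d lambda t = lambda * lens_area d t.
Proof.
move=> d0 dt; rewrite /mu_fb /lens_area; case: eqVneq => [->|td].
  by rewrite subrr sqrtr0 divff ?gt_eqF// acos1; field.
rewrite acos_atan ?d0/=; first by field.
by rewrite lt_neqAle eq_sym td.
Qed.

Lemma F_Gamma_optE d lambda t : 0 < d -> d <= t ->
  F_Gamma_opt d lambda t = 1 - expR (- (lambda * lens_area d t)).
Proof.
move=> d0 dt; rewrite /F_Gamma_opt ltNge dt/=; congr (1 - expR (- _)).
rewrite /arcsec invf_div /lens_area.
have -> : Num.sqrt ((t / d) ^+ 2 - 1) = Num.sqrt (t ^+ 2 - d ^+ 2) / d.
  have -> : (t / d) ^+ 2 - 1 = (t ^+ 2 - d ^+ 2) * d ^- 2 by field; rewrite gt_eqF.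
  rewrite sqrtrM ?subr_ge0 ?ler_sqr ?nnegrE; [|lra..].
  by rewrite sqrtrV ?sqr_ge0// sqrtr_sqr gtr0_norm.
by field; rewrite gt_eqF.
Qed.

(** The slices are those of the lens with d = 0. This area identifies the push-forward by [sqmod] in
    the Rayleigh case. *)
Lemma area_disc (r : R) : 0 <= r ->
  area [set z | sqmod z <= r] = (pi * r)%:E.
Proof.
move=> r0; set t := Num.sqrt r; have tt : t ^+ 2 = r by rewrite sqr_sqrtr.
have t0 : 0 <= t by rewrite sqrtr_ge0.
transitivity (\int[mu]_(x in `[(- t)%R, t]) (2 * (Num.sqrt (t ^+ 2 - x ^+ 2) - 0))%:E)%E.
  rewrite [RHS]integral_mkcond; apply: eq_integral => x _ /=.
  rewrite patchE mem_setE in_itv/= -ler_norml.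
  have := lebesgue_measure_slice x (lexx 0) t0.
  rewrite (_ : t ^+ 2 - 0 ^+ 2 = t ^+ 2); last by ring.
  rewrite sqrtr_sqr (ger0_norm t0) => h; apply: etrans h; congr (mu _).
  by apply/seteqP; split => y; rewrite /xsection/= inE/= /sqmod/= addr0 real_normK ?num_real// tt.
have := t0; rewrite le_eqVlt => /predU1P[t00|t00].
  by rewrite -t00 oppr0 set_itv1 integral_set1 -tt -t00 expr0n mulr0.
rewrite integral_chord ?t00 ?lexx// subrr sqrtr0 addr0 divff ?gt_eqF// atan1.
by rewrite tt; congr EFin; field.
Qed.

End planar_area.

(** * Conditional expectation given the point process *)

(** Independence makes the joint law of [U] and [V] a product measure, to which Tonelli's theorem
    applies. *)
Lemma integral_indep d d1 d2 (T : measurableType d) (T1 : measurableType d1)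
    (T2 : measurableType d2) (R : realType) (P : probability T R)
    (nu : probability T2 R) (U : T -> T1) (V : T -> T2) (f : T1 * T2 -> \bar R) :
  measurable_fun setT U -> measurable_fun setT V ->
  measurable_fun setT f -> (forall p, 0 <= f p)%E ->
  (forall A B, measurable A -> measurable B ->
    P (U @^-1` A `&` V @^-1` B) = P (U @^-1` A) * nu B)%E ->
  (\int[P]_w f (U w, V w) = \int[P]_w \int[nu]_z f (U w, z))%E.
Proof.
move=> mU mV mf f0 ind.
have mUV : measurable_fun setT (fun w => (U w, V w)) by exact: measurable_fun_pair.
pose U' : {mfun T >-> T1} := mfun_Sub (mem_set mU).
pose UV : {mfun T >-> (T1 * T2)%type} := mfun_Sub (mem_set mUV).
rewrite -[LHS](@ge0_integral_distribution _ _ _ _ _ P UV)//.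
rewrite (eq_measure_integral (distribution P U' \x nu)%E); last first.
  move=> A mA _; apply/esym; exact: product_measure_unique.
rewrite fubini_tonelli1// -[LHS]/(\int[distribution P U']_x fubini_F nu f x)%E.
rewrite ge0_integral_distribution//.
  exact: measurable_fun_fubini_tonelli_F.
by move=> x; apply: integral_ge0.
Qed.

(** * Measurability of monotone functions and of the logarithm *)

Section extended_real_measurability.
Context {R : realType}.

Lemma nonincreasing_emeasurable (f : R -> \bar R) :
  (forall x y, x <= y -> (f y <= f x)%E) -> measurable_fun setT f.
Proof.
move=> fni; apply: (measurability (@ErealGenOInfty.G R)) => [|/= _ [_] [r] -> <-].
  exact: ErealGenOInfty.measurableE.
rewrite setTI; apply: is_interval_measurable => s t/=.
rewrite !in_itv/= !andbT => fs ft u /andP[su ut].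
by rewrite in_itv/= andbT (lt_le_trans ft)// fni.
Qed.

Lemma measurable_lne : measurable_fun setT (@lne R).
Proof.
apply: (measurability (@ErealGenOInfty.G R)) => [|/= _ [_] [r] -> <-].
  exact: ErealGenOInfty.measurableE.
rewrite setTI (_ : _ @^-1` _ = `](expR r)%:E, +oo[%classic); first exact: emeasurable_itv.
apply/seteqP; split => x /=; rewrite !in_itv/= !andbT.
  move=> rx; rewrite -[x]lneK ?(lte_expeR r%:E)// in_itv/= leey andbT leNgt.
  by apply/negP => x0; move: rx; rewrite le0_lneNy// ltW.
move=> rx; rewrite -(lte_expeR r%:E) lneK// in_itv/= leey andbT.
by apply: le_trans (ltW rx); rewrite lee_fin expR_ge0.
Qed.

Lemma ln2_gt0 : 0 < ln 2 :> R.
Proof. by rewrite ln_gt0// ltr1n. Qed.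

Lemma measurable_log2e : measurable_fun setT (@log2e R).
Proof. by apply: emeasurable_funM; [exact: measurable_lne|exact: measurable_cst]. Qed.

Lemma log2e_ge0 (x : \bar R) : (0 <= x)%E -> (0 <= log2e (1 + x))%E.
Proof.
move=> x0; rewrite mule_ge0 ?lne_ge0 ?leeDl// lee_fin invr_ge0 ltW//.
exact: ln2_gt0.
Qed.

Lemma le_log2e (x y : \bar R) : (0 <= x)%E -> (x <= y)%E ->
  (log2e (1 + x) <= log2e (1 + y))%E.
Proof.
move=> x0 xy; apply: lee_wpmul2r; first by rewrite lee_fin invr_ge0 (ltW ln2_gt0).
have y0 := le_trans x0 xy.
by rewrite lee_lne ?in_itv/= ?leey ?adde_ge0// leeD2l.
Qed.

End extended_real_measurability.

Section conditional_expectation.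
Context (disp : measure_display) (Omega : measurableType disp) (R : realType).
Variables (P : probability Omega R) (Phi : Omega -> set (plane R)) (lambda : R).
Hypothesis hPhi : poisson_process P Phi lambda.

Let gen : set_system Omega := [set A | exists B k,
  measurable B /\ A = [set w | pp_count Phi B w = (k : nat)%:R%:E]].

(** [Omega] endowed with sigma(Phi), so that general measurability lemmas apply to sigma(Phi). *)
Let Omega_pp := g_sigma_algebraType gen.

Lemma sigma_pp_measurable A : sigma_pp Phi A -> measurable A.
Proof.
apply: smallest_sub; first exact: sigma_algebra_measurable.
move=> _ [B [k [mB ->]]]; case: hPhi => _ mc _ _.
by have := mc B mB measurableT _ (emeasurable_set1 k%:R%:E); rewrite setTI.
Qed.

Lemma pp_measurable_measurable d' (T' : measurableType d') (f : Omega -> T') :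
  pp_measurable Phi f -> measurable_fun setT f.
Proof. by move=> mf _ B mB; rewrite setTI; apply: sigma_pp_measurable; exact: mf. Qed.

Lemma sigma_ppI A B : sigma_pp Phi A -> sigma_pp Phi B -> sigma_pp Phi (A `&` B).
Proof. exact: (@measurableI _ Omega_pp). Qed.

Lemma pp_measurable_comp d1 d2 (T1 : measurableType d1) (T2 : measurableType d2)
    (f : Omega -> T1) (g : T1 -> T2) :
  pp_measurable Phi f -> measurable_fun setT g -> pp_measurable Phi (g \o f).
Proof.
move=> mf mg B mB; rewrite comp_preimage; apply: mf.
by rewrite -[X in measurable X]setTI; exact: mg.
Qed.

(* Apply [integral_indep] to the identity from [Omega] to [Omega] endowed with
   sigma(Phi): this is the freezing lemma for sigma(Phi)-measurable [X]. *)
Lemma pp_integral_indep d1 d2 (T1 : measurableType d1) (T2 : measurableType d2)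
    (nu : probability T2 R) (X : Omega -> T1) (H : {RV P >-> T2})
    (f : T1 * T2 -> \bar R) A :
  pp_measurable Phi X -> pp_independent P Phi H ->
  (forall A, measurable A -> distribution P H A = nu A) ->
  measurable_fun setT f -> (forall p, 0 <= f p)%E -> sigma_pp Phi A ->
  (\int[P]_(w in A) f (X w, H w) = \int[P]_(w in A) \int[nu]_z f (X w, z))%E.
Proof.
move=> mX iH lH mf f0 sA; have mA := sigma_pp_measurable sA.
(* Restriction to [A] becomes multiplication by its indicator, a measurable function of the first
   argument because [A] is in sigma(Phi). *)
pose g (p : Omega_pp * T2) : \bar R := (f (X p.1, p.2) * (\1_A p.1)%:E)%E.
have mg : measurable_fun setT g.
  apply: emeasurable_funM.
    apply: (measurableT_comp mf); apply: measurable_fun_pair => //.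
    have mX' : @measurable_fun _ _ Omega_pp T1 setT X by move=> _ B mB; rewrite setTI; exact: mX.
    exact: (measurableT_comp mX').
  apply/measurable_EFinP.
  have mA' : @measurable_fun _ _ Omega_pp _ setT (\1_A : _ -> R) by exact: measurable_indic.
  exact: (measurableT_comp mA').
have mid : @measurable_fun _ _ Omega Omega_pp setT (fun w => w).
  by move=> _ B sB; rewrite setTI; exact: sigma_pp_measurable.
have mH : measurable_fun setT H by [].
have g0 p : (0 <= g p)%E by rewrite mule_ge0// lee_fin.
have ind B C : @measurable _ Omega_pp B -> measurable C ->
    (P ((fun w => w) @^-1` B `&` H @^-1` C) = P ((fun w => w) @^-1` B) * nu C)%E.
  by move=> mB mC; rewrite -lH//; exact: iH.
have := integral_indep mid mH mg g0 ind; rewrite /g/=.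
move=> e; rewrite [LHS]integral_mkcond epatch_indic; apply: (etrans e).
rewrite [RHS]integral_mkcond epatch_indic.
apply: eq_integral => w _ /=; rewrite indicE; case: (w \in A); rewrite /= ?mule1 ?mule0.
  by under eq_integral do rewrite mule1.
by under eq_integral do rewrite mule0; rewrite integral0.
Qed.

(** The event Z < K is covered by the events [A n] where Z <= n and Z + 1 / (n + 1) <= K. The bound
    n makes the integral of Z over [A n] finite, so it can be cancelled, which forces P (A n) / (n +
    1) <= 0. *)
Lemma pp_lt_negligible (Z K : Omega -> \bar R) :
  (forall w, 0 <= Z w)%E -> pp_measurable Phi Z -> pp_measurable Phi K ->
  (forall A, sigma_pp Phi A -> \int[P]_(w in A) K w <= \int[P]_(w in A) Z w)%E ->
  P.-negligible [set w | (Z w < K w)%E].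
Proof.
move=> Z0 mZ mK KZ.
pose A n := [set w | (Z w <= n%:R%:E)%E] `&` [set w | (Z w + n.+1%:R^-1%:E <= K w)%E].
have mZ' := pp_measurable_measurable mZ; have mK' := pp_measurable_measurable mK.
have mZpp : @measurable_fun _ _ Omega_pp _ setT Z by move=> _ B mB; rewrite setTI; exact: mZ.
have mKpp : @measurable_fun _ _ Omega_pp _ setT K by move=> _ B mB; rewrite setTI; exact: mK.
have sA n : sigma_pp Phi (A n).
  apply: sigma_ppI.
    by rewrite -[X in sigma_pp Phi X]setTI; exact: (@emeasurable_fun_infty_c _ Omega_pp).
  rewrite -[X in sigma_pp Phi X]setTI; apply: (@measurable_lee _ Omega_pp) => //.
  by apply: emeasurable_funD => //; exact: measurable_cst.
apply: (@negligibleS _ _ _ P (\bigcup_n A n)); last first.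
  apply: negligible_bigcup => n; have mA := sigma_pp_measurable (sA n).
  exists (A n); split => //.
  have mZA : measurable_fun (A n) Z by exact: measurable_funTS.
  have IZ : (\int[P]_(w in A n) Z w <= n%:R%:E * P (A n))%E.
    rewrite -integral_cst//; apply: ge0_le_integral => //.
    by move=> w [].
  have q0 : (0 <= n.+1%:R^-1%:E :> \bar R)%E by rewrite lee_fin invr_ge0.
  have IK : (\int[P]_(w in A n) Z w + n.+1%:R^-1%:E * P (A n) <= \int[P]_(w in A n) Z w)%E.
    apply: le_trans (KZ _ (sA n)); rewrite -integral_cst// -ge0_integralD//.
    apply: ge0_le_integral => //.
    - by move=> w _; rewrite adde_ge0.
    - by apply: emeasurable_funD => //; exact: measurable_cst.
    - exact: measurable_funTS.
    - by move=> w [].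
  have Ifin : (\int[P]_(w in A n) Z w \is a fin_num)%E.
    rewrite ge0_fin_numE ?integral_ge0//; apply: le_lt_trans IZ _.
    by rewrite lte_mul_pinfty// ltey_eq fin_num_measure.
  apply/eqP; rewrite eq_le measure_ge0 andbT.
  rewrite leNgt; apply/negP => PA0; move: IK; rewrite leNgt => /negP; apply.
  by rewrite lteDl// mule_gt0// lte_fin invr_gt0.
move=> w /= ZK.
have Zfin : Z w \is a fin_num by rewrite ge0_fin_numE//; apply: lt_le_trans ZK _; exact: leey.
have [m hm] : exists m : nat, (Z w + m.+1%:R^-1%:E <= K w)%E.
  move: ZK Zfin; case: (Z w) => [z| |]//; case: (K w) => [k| |]//; last by exists 0%N; rewrite leey.
  rewrite lte_fin -subr_gt0 => zk _; exists (Num.truncn (k - z)^-1).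
  rewrite -EFinD lee_fin -lerBrDl -[leRHS]invrK lef_pV2 ?posrE ?invr_gt0//.
  by rewrite ltW// truncnS_gt.
have [n1 hn1] : exists n : nat, (Z w <= n%:R%:E)%E.
  exists (Num.truncn (fine (Z w))).+1; by rewrite -[leLHS](fineK Zfin) lee_fin ltW// truncnS_gt.
exists (maxn m n1) => //; split => /=.
  by apply: le_trans hn1 _; rewrite lee_fin ler_nat leq_maxr.
apply: le_trans hm; rewrite leeD2l// lee_fin lef_pV2 ?posrE// ler_nat ltnS.
exact: leq_maxl.
Qed.

Lemma pp_cond_exp_unique (Y Z K : Omega -> \bar R) :
  pp_cond_exp P Phi Y Z -> pp_cond_exp P Phi Y K -> {ae P, forall w, Z w = K w}.
Proof.
move=> [Z0 mZ ZY] [K0 mK KY].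
have ZK A : sigma_pp Phi A -> (\int[P]_(w in A) K w = \int[P]_(w in A) Z w)%E.
  by move=> sA; rewrite KY// ZY.
have N1 : P.-negligible [set w | (Z w < K w)%E].
  by apply: pp_lt_negligible => // A /ZK ->.
have N2 : P.-negligible [set w | (K w < Z w)%E].
  by apply: pp_lt_negligible => // A /ZK ->.
apply: negligibleS (negligibleU N1 N2) => w /= /eqP; rewrite neq_lt => /orP[]; tauto.
Qed.

End conditional_expectation.

(** * Outage in terms of the nearest relay *)

Section outage.
Context (disp : measure_display) (Omega : measurableType disp) (R : realType).

Lemma le_measure_negligible (P : probability Omega R) (A B : set Omega) :
  measurable A -> measurable B -> P.-negligible (A `\` B) -> (P A <= P B)%E.
Proof.
move=> mA mB [N [mN N0 ABN]].
apply: (@le_trans _ _ (P (B `|` N))).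
  apply: le_measure; rewrite ?inE//; first exact: measurableU.
  by move=> w Aw; have [Bw|nBw] := pselect (B w); [left|right; apply: ABN].
by rewrite measureU0.
Qed.

Variables (P : probability Omega R) (Phi : Omega -> set (plane R)).
Variables (lambda d SNR T : R) (xs xd : plane R) (G : R -> \bar R).
Hypotheses (d0 : 0 < d) (SNR0 : 0 < SNR) (dT : d <= T).
Hypothesis dist_sd : eucl_dist xs xd = 2 * d.
Hypothesis hG : path_loss G.
Hypothesis hPhi : poisson_process P Phi lambda.

(** * Geometry of [shat] and void probabilities *)

Lemma eucl_dist_ge0 (x y : plane R) : 0 <= eucl_dist x y.
Proof. exact: sqrtr_ge0. Qed.

Lemma sqr_eucl_dist (x y : plane R) :
  eucl_dist x y ^+ 2 = (x.1 - y.1) ^+ 2 + (x.2 - y.2) ^+ 2.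
Proof. by rewrite sqr_sqrtr// addr_ge0// sqr_ge0. Qed.

(* Parallelogram law: |xs - x|^2 + |x - xd|^2 >= |xs - xd|^2 / 2 = 2 d^2. *)
Lemma shat_ge (x : plane R) : d <= shat xs xd x.
Proof.
rewrite leNgt gt_max; apply/negP => /andP[].
have sq y : 0 <= y -> y < d -> y ^+ 2 < d ^+ 2.
  by move=> y0 yd; rewrite ltr_sqr ?nnegrE// ltW.
move=> /(sq _ (eucl_dist_ge0 _ _)) + /(sq _ (eucl_dist_ge0 _ _)).
have := sqr_eucl_dist xs xd; rewrite dist_sd !sqr_eucl_dist.
set a := xs.1 - x.1; set b := xs.2 - x.2; set a' := x.1 - xd.1; set b' := x.2 - xd.2.
have -> : xs.1 - xd.1 = a + a' by rewrite /a /a'; ring.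
have -> : xs.2 - xd.2 = b + b' by rewrite /b /b'; ring.
have := sqr_ge0 (a - a'); have := sqr_ge0 (b - b'); nra.
Qed.

Lemma bounded_lens t : bounded_region (shat xs xd @^-1` [set u | u <= t]).
Proof.
(* From |x|^2 <= 2 |xs - x|^2 + 2 |xs|^2. *)
exists (Num.sqrt (2 * t ^+ 2 + 2 * (xs.1 ^+ 2 + xs.2 ^+ 2))) => x /=.
rewrite ge_max => /andP[xt _].
have : eucl_dist xs x ^+ 2 <= t ^+ 2.
  by rewrite ler_sqr ?nnegrE ?eucl_dist_ge0// (le_trans _ xt) ?eucl_dist_ge0.
rewrite sqr_eucl_dist => h; rewrite ler_sqrt; last first.
  by rewrite addr_ge0// mulr_ge0// ?addr_ge0 ?sqr_ge0.
rewrite /=; have := sqr_ge0 (2 * xs.1 - x.1); have := sqr_ge0 (2 * xs.2 - x.2); nra.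
Qed.

Lemma pp_count_eq0 (B : set (plane R)) w : bounded_region B ->
  pp_count Phi B w = 0%:R%:E <-> Phi w `&` B = set0.
Proof.
case: hPhi => fin _ _ _ bB; have fB := fin w B bB.
rewrite /pp_count /counting asboolT//; split => [[]|->]; last by rewrite fset_set0.
by move=> /eqP; rewrite pnatr_eq0 finmap.cardfs_eq0 => /eqP/(fset_set_set0 fB).
Qed.

Lemma measurable_lens (B : set R) : measurable B -> measurable (shat xs xd @^-1` B).
Proof. by move=> mB; rewrite -[X in measurable X]setTI; exact: measurable_shat. Qed.

Definition no_relay (B : set (plane R)) : set Omega := [set w | Phi w `&` B = set0].

Lemma no_relay_prob (B : set (plane R)) (a : R) : measurable B -> bounded_region B ->
  area B = a%:E -> measurable (no_relay B) /\ P (no_relay B) = (expR (- (lambda * a)))%:E.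
Proof.
move=> mB bB aB; have -> : no_relay B = [set w | pp_count Phi B w = 0%:R%:E].
  by apply/seteqP; split => w /pp_count_eq0; exact.
case: hPhi => _ mc Pc _; split.
  by have := mc B mB measurableT _ (emeasurable_set1 0%:R%:E); rewrite setTI.
by rewrite Pc// aB/= expr0 mulr1 fact0 divr1.
Qed.

(** The argument is an extended real because [G] may be +oo at 0. The factor 1/2 of the rate is left
    out. *)
Definition ergodic_rate (nu : probability (plane R) R) (x : \bar R) : \bar R :=
  (\int[nu]_z log2e (1 + (sqmod z)%:E * x))%E.

Lemma measurable_sqmod : measurable_fun [set: plane R] (@sqmod R).
Proof. by apply: measurable_funD; apply: measurable_funX. Qed.

Lemma sqmod_ge0 (z : plane R) : 0 <= sqmod z.
Proof. by rewrite addr_ge0// sqr_ge0. Qed.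

Lemma measurable_rate_integrand (x : \bar R) :
  measurable_fun [set: plane R] (fun z => log2e (1 + (sqmod z)%:E * x)%E).
Proof.
apply: (measurableT_comp measurable_log2e); apply: emeasurable_funD => //.
apply: emeasurable_funM; last exact: measurable_cst.
by apply/measurable_EFinP; exact: measurable_sqmod.
Qed.

Lemma ergodic_rate_ge0 nu x : (0 <= x)%E -> (0 <= ergodic_rate nu x)%E.
Proof.
by move=> x0; apply: integral_ge0 => z _; rewrite log2e_ge0// mule_ge0// lee_fin sqmod_ge0.
Qed.

Lemma le_ergodic_rate nu x y : (0 <= x)%E -> (x <= y)%E ->
  (ergodic_rate nu x <= ergodic_rate nu y)%E.
Proof.
move=> x0 xy; have z0 z : (0 <= (sqmod z)%:E :> \bar R)%E by rewrite lee_fin sqmod_ge0.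
apply: ge0_le_integral => //.
- by move=> z _; rewrite log2e_ge0// mule_ge0.
- exact: measurable_rate_integrand.
- exact: measurable_rate_integrand.
- by move=> z _; rewrite le_log2e ?mule_ge0// lee_wpmul2l.
Qed.

(** [G] is constrained on [0, +oo[ only, so it is composed with truncation at 0 to become
    non-increasing on the whole line, hence measurable. *)
Lemma measurable_path_loss (f : plane R -> R) : (forall x, 0 <= f x) ->
  measurable_fun [set: plane R] f -> measurable_fun [set: plane R] (fun x => G (f x)).
Proof.
move=> f0 mf; have -> : (fun x => G (f x)) = (fun r => G (Num.max r 0)) \o f.
  by apply/funext => x /=; rewrite max_l.
apply: measurableT_comp => //; apply: nonincreasing_emeasurable => x y xy.
case: hG => _ Gni _ _; apply: Gni; first by rewrite le_max lexx orbT.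
by rewrite ge_max !le_max lexx xy orbT.
Qed.

(** The integral identity over events of sigma(Phi) is [pp_integral_indep]; measurability with
    respect to sigma(Phi) holds because the rate is a partial integral of [h], measurable by
    Tonelli, composed with [X]. *)
Lemma pp_cond_exp_fading (nu : probability (plane R) R)
    (H : {RV P >-> plane R}) (X : Omega -> plane R)
    (f : plane R -> R) :
  (forall A, measurable A -> distribution P H A = nu A) -> pp_independent P Phi H ->
  pp_measurable Phi X -> (forall x, 0 <= f x) -> measurable_fun [set: plane R] f ->
  pp_cond_exp P Phi
    (fun w => log2e (1 + (SNR * sqmod (H w))%:E * G (f (X w)))%E)
    (fun w => ergodic_rate nu (SNR%:E * G (f (X w)))%E).
Proof.
move=> lH iH mX f0 mf.
have mGf := measurable_path_loss f0 mf.
have G0 x : (0 <= G (f x))%E by case: hG => G0 _ _ _; exact: G0.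
pose h (p : plane R * plane R) : \bar R :=
  log2e (1 + (SNR * sqmod p.2)%:E * G (f p.1))%E.
have mh : measurable_fun setT h.
  apply: (measurableT_comp measurable_log2e); apply: emeasurable_funD => //.
  apply: emeasurable_funM; last exact: (measurableT_comp mGf).
  apply/measurable_EFinP; apply: measurable_funM => //.
  exact: (measurableT_comp measurable_sqmod).
have h0 p : (0 <= h p)%E.
  by rewrite log2e_ge0// mule_ge0// lee_fin mulr_ge0 ?sqmod_ge0// ltW.
have hE x : ergodic_rate nu (SNR%:E * G (f x)) = (\int[nu]_z h (x, z))%E.
  apply: eq_integral => z _; rewrite /h/= muleA -EFinM mulrC //.
split.
- by move=> w; apply: ergodic_rate_ge0; rewrite mule_ge0// lee_fin ltW.
- have -> : (fun w => ergodic_rate nu (SNR%:E * G (f (X w)))%E) = fubini_F nu h \o X.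
    by apply/funext => w; exact: hE.
  apply: (pp_measurable_comp mX); exact: measurable_fun_fubini_tonelli_F.
- move=> A sA; rewrite (pp_integral_indep hPhi mX iH lH mh h0 sA).
  by apply: eq_integral => w _; exact: hE.
Qed.

Lemma path_loss_max a b : 0 <= a -> 0 <= b ->
  mine (SNR%:E * G a)%E (SNR%:E * G b)%E = (SNR%:E * G (Num.max a b))%E.
Proof.
move=> a0 b0; case: hG => _ Gni _ _.
have SNR0' : (0 <= SNR%:E :> \bar R)%E by rewrite lee_fin ltW.
by case: (leP a b) => ab; [rewrite min_r|rewrite min_l]; rewrite ?lee_wpmul2l// Gni// ltW.
Qed.

Lemma ergodic_rate_min nu x y : (0 <= x)%E -> (0 <= y)%E ->
  mine (ergodic_rate nu x) (ergodic_rate nu y) = ergodic_rate nu (mine x y).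
Proof.
move=> x0 y0; case: (leP x y) => xy; first by rewrite min_l// le_ergodic_rate.
by rewrite min_r// le_ergodic_rate// ltW.
Qed.

(** The smaller of the two ergodic rates belongs to the smaller SNR, hence to the larger distance,
    which is [shat]. The identity is almost sure because versions of a conditional expectation agree
    only up to a null event. *)
Lemma fb_rate_ae (nu : probability (plane R) R)
    (Hsr Hrd : {RV P >-> plane R}) (Xstar : Omega -> plane R)
    (rate : Omega -> \bar R) :
  (forall A, measurable A -> distribution P Hsr A = nu A) ->
  (forall A, measurable A -> distribution P Hrd A = nu A) ->
  pp_independent P Phi Hsr -> pp_independent P Phi Hrd ->
  fb_selection Phi xs xd T Xstar ->
  fb_rate P Phi xs xd T SNR G Hsr Hrd Xstar rate ->
  {ae P, forall w, rate w = if `[< feedback Phi xs xd T w !=set0 >]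
    then (2^-1%:E * ergodic_rate nu (SNR%:E * G (shat xs xd (Xstar w))))%E else 0%E}.
Proof.
move=> lsr lrd isr ird [mX _] [Zsr [Zrd [csr crd rateE]]].
have mxd : measurable_fun [set: plane R] (fun x => eucl_dist x xd).
  by under eq_fun do rewrite eucl_distC; exact: measurable_eucl_dist.
have := pp_cond_exp_unique hPhi csr (pp_cond_exp_fading lsr isr mX
  (eucl_dist_ge0 xs) (measurable_eucl_dist xs)).
have := pp_cond_exp_unique hPhi crd (pp_cond_exp_fading lrd ird mX
  (fun x => eucl_dist_ge0 x xd) mxd).
apply: filterS2 => w rd sr; rewrite rateE rd sr; case: asboolP => // _.
congr (_ * _)%E; rewrite /shat -path_loss_max ?eucl_dist_ge0//.
case: hG => G0 _ _ _.
have SG0 a : 0 <= a -> (0 <= SNR%:E * G a)%E.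
  by move=> a0; rewrite mule_ge0 ?lee_fin ?(ltW SNR0)// G0.
by rewrite ergodic_rate_min// SG0// eucl_dist_ge0.
Qed.

(** The event that some relay feeds back is the complement of a void event of a lens, hence
    measurable. *)
Lemma measurable_fb_rate (Hsr Hrd : {RV P >-> plane R}) (Xstar : Omega -> plane R)
    (rate : Omega -> \bar R) :
  fb_rate P Phi xs xd T SNR G Hsr Hrd Xstar rate -> measurable_fun setT rate.
Proof.
move=> [Zsr [Zrd [[_ msr _] [_ mrd _] rateE]]].
have [mN _] := no_relay_prob (measurable_lens (measurable_le_set T))
  (bounded_lens T) (area_lens d0 dT dist_sd).
have -> : rate = (fun w => 2^-1%:E * mine (Zsr w) (Zrd w))%E \_
    (~` no_relay (shat xs xd @^-1` [set u | u <= T])).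
  apply/funext => w; rewrite rateE patchE; case: asboolP => [[x [Px xT]]|h].
    by rewrite mem_set// => e; have : set0 x by rewrite -e.
  rewrite memNset//= => e; apply: e; apply/seteqP; split => // x [Px xT].
  by apply: h; exists x.
have mmin : measurable_fun setT (fun w => mine (Zsr w) (Zrd w)).
  by apply: measurable_mine; apply: (pp_measurable_measurable hPhi).
apply/(measurable_restrictT _ (measurableC mN)); apply: measurable_funTS.
by apply: (emeasurable_funM (measurable_cst (2^-1%:E : \bar R)) mmin).
Qed.

Lemma SNR_path_loss_fin (x : R) : 0 < x ->
  (0 <= SNR%:E * G x)%E /\ (SNR%:E * G x)%E \is a fin_num.
Proof.
move=> x0; case: hG => G0 _ Gfin _; have Gx0 := G0 x (ltW x0); split.
  by rewrite mule_ge0// lee_fin ltW.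
by rewrite fin_numM// ge0_fin_numE ?Gfin.
Qed.

Lemma SNR_path_loss_le (x y : R) : 0 <= x -> x <= y ->
  (SNR%:E * G y <= SNR%:E * G x)%E.
Proof.
move=> x0 xy; case: hG => _ Gni _ _.
by apply: lee_wpmul2l; [rewrite lee_fin ltW|exact: Gni].
Qed.

(** * Outage for an SNR [s] at which half the ergodic rate equals [rho] *)

Section threshold.
Variables (nu : probability (plane R) R) (Xstar : Omega -> plane R).
Variables (rate : Omega -> \bar R) (s rho : R).
Hypotheses (rho0 : 0 < rho) (s0 : 0 <= s).
Hypothesis rate_mono : forall x y : R, 0 <= x -> x < y ->
  (ergodic_rate nu x%:E < ergodic_rate nu y%:E)%E.
Hypothesis rate_s : (2^-1%:E * ergodic_rate nu s%:E = rho%:E)%E.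
Hypothesis mrate : measurable_fun setT rate.
Hypothesis selX : fb_selection Phi xs xd T Xstar.
Hypothesis rateE : {ae P, forall w, rate w =
  if `[< feedback Phi xs xd T w !=set0 >]
  then (2^-1%:E * ergodic_rate nu (SNR%:E * G (shat xs xd (Xstar w))))%E else 0%E}.

(** Strict monotonicity carries comparisons between rates and SNRs back and forth. The bound
    [d <= x] keeps the SNR finite, the range in which [rate_mono] speaks. *)
Lemma half_ergodic_rate_le x : d <= x ->
  (2^-1%:E * ergodic_rate nu (SNR%:E * G x) <= rho%:E)%E = (SNR%:E * G x <= s%:E)%E.
Proof.
move=> dx; have [SG0 SGfin] := SNR_path_loss_fin (lt_le_trans d0 dx).
have half0 : (0 < 2^-1%:E :> \bar R)%E by rewrite lte_fin invr_gt0.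
rewrite -rate_s; case: (leP (SNR%:E * G x)%E s%:E) => [le|].
  by apply: lee_wpmul2l; [exact: ltW|exact: le_ergodic_rate].
rewrite -(fineK SGfin) lte_fin => lt; apply/negbTE; rewrite -ltNge.
by rewrite lte_pmul2l// rate_mono.
Qed.

Lemma half_ergodic_rate_ge x : d <= x ->
  (rho%:E <= 2^-1%:E * ergodic_rate nu (SNR%:E * G x))%E = (s%:E <= SNR%:E * G x)%E.
Proof.
move=> dx; have [SG0 SGfin] := SNR_path_loss_fin (lt_le_trans d0 dx).
have half0 : (0 < 2^-1%:E :> \bar R)%E by rewrite lte_fin invr_gt0.
rewrite -rate_s; case: (leP s%:E (SNR%:E * G x)%E) => [le|].
  by apply: lee_wpmul2l; [exact: ltW|exact: le_ergodic_rate].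
move: SG0; rewrite -(fineK SGfin) lte_fin lee_fin => SG0 lt.
by apply/negbTE; rewrite -ltNge lte_pmul2l// rate_mono.
Qed.

Let measurable_outage : measurable [set w | (rate w <= rho%:E)%E].
Proof. by rewrite -[X in measurable X]setTI; exact: emeasurable_fun_infty_c. Qed.

(** Without feedback the rate is 0, below [rho], so only the selected relay has to be examined. *)
Lemma outage_sub (A : set Omega) : measurable A ->
  (forall w, A w -> feedback Phi xs xd T w !=set0 ->
    (SNR%:E * G (shat xs xd (Xstar w)) <= s%:E)%E) ->
  (P A <= outage P rate rho)%E.
Proof.
move=> mA AX; apply: le_measure_negligible => //.
apply: negligibleS rateE => w [Aw /negP]; rewrite -ltNge => lt e.
move: lt; rewrite {}e; case: asboolP => [fb|_]; last by rewrite lte_fin ltNge ltW.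
by rewrite ltNge half_ergodic_rate_le ?AX// shat_ge.
Qed.

Lemma sub_outage (A : set Omega) : measurable A ->
  (forall w, ~ A w -> feedback Phi xs xd T w !=set0 /\
    (s%:E < SNR%:E * G (shat xs xd (Xstar w)))%E) ->
  (outage P rate rho <= P A)%E.
Proof.
move=> mA AX; apply: le_measure_negligible => //.
apply: negligibleS rateE => w [/= + /AX[fb lt]] e; rewrite {}e asboolT//.
by rewrite half_ergodic_rate_le ?shat_ge// leNgt lt.
Qed.

(* Up to the null event that the best relay is exactly at [shat = g], outage
   means that no relay lies in the lens [shat <= g]. *)
Lemma outage_lens (g : R) : d <= g <= T ->
  (forall x, g < x <= T -> (SNR%:E * G x <= s%:E)%E) ->
  (forall x, d <= x < g -> (s%:E < SNR%:E * G x)%E) ->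
  outage P rate rho = (expR (- (lambda * lens_area d g)))%:E.
Proof.
move=> /andP[dg gT] far near; case: selX => _ sel.
have [mN PN] := no_relay_prob (measurable_lens (measurable_le_set g))
  (bounded_lens g) (area_lens d0 dg dist_sd).
have bo : bounded_region (shat xs xd @^-1` [set u | u < g]).
  by have [r hr] := bounded_lens g; exists r => x xg; apply: hr; exact: ltW.
have [mN' PN'] := no_relay_prob (measurable_lens (measurable_lt_set g))
  bo (area_open_lens d0 dg dist_sd).
(* Up to null events, outage contains the void event of the closed lens and is contained in that of
   the open one; the two lenses have equal area. *)
apply/eqP; rewrite eq_le -{1}PN' -PN; apply/andP; split.
  apply: sub_outage => // w /eqP/set0P[x [Px xg]].
  have xfb : feedback Phi xs xd T w x by split => //; apply: le_trans gT; exact: ltW.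
  split; first by exists x.
  have [_ /(_ x xfb) Xx] := sel w (ex_intro _ x xfb).
  by apply: near; rewrite shat_ge (le_lt_trans Xx).
apply: outage_sub => // w Nw fb; have [[PX XT] _] := sel w fb.
apply: far; rewrite XT andbT ltNge; apply/negP => Xg.
by have : set0 (Xstar w) by rewrite -[set0]Nw.
Qed.

(** The lens has radius [T]: a relay strictly inside it must have rate above [rho]. When [s] equals
    SNR G(T) this requires G to exceed G(T) before [T]; on a flat stretch ending at [T] the rate
    would be exactly [rho], which counts as outage. *)
Lemma outage_below :
  (s%:E <= SNR%:E * G T)%E ->
  (s%:E = (SNR%:E * G T)%E -> forall x, d <= x < T -> (G T < G x)%E) ->
  outage P rate rho = (expR (- mu_fb d lambda T))%:E.
Proof.
move=> sT strict; rewrite mu_fbE//; apply: outage_lens; first by rewrite dT lexx.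
  by move=> x /andP[/lt_le_trans h /h]; rewrite ltxx.
move=> x /andP[dx xT]; have x0 : 0 <= x by apply: le_trans dx; exact: ltW.
move: sT; rewrite le_eqVlt => /predU1P[e|lt].
  by rewrite e lte_pmul2l ?lte_fin// strict// dx xT.
exact: lt_le_trans lt (SNR_path_loss_le x0 (ltW xT)).
Qed.

(** The generalized inverse separates the distances at which SNR G exceeds [s] from those at which
    it does not; exactly at it either may occur, on a null event. *)
Lemma outage_between : (SNR%:E * G T < s%:E)%E -> (s%:E < SNR%:E * G d)%E ->
  outage P rate rho = (F_S_opt d lambda SNR G s)%:E.
Proof.
move=> Ts sd.
have GsE x : (G x <= (s / SNR)%:E)%E = (SNR%:E * G x <= s%:E)%E.
  by rewrite mulrC EFinM lee_pdivlMl.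
pose S := [set x | 0 <= x /\ (G x <= (s / SNR)%:E)%E].
have ST : S T by split; [apply: le_trans dT; exact: ltW|rewrite GsE ltW].
have Sd : lbound S d.
  move=> x [x0]; rewrite GsE leNgt => /negP xs'; rewrite leNgt; apply/negP => xd'.
  by apply: xs'; apply: lt_le_trans sd (SNR_path_loss_le x0 (ltW xd')).
have dg : d <= ginv G (s / SNR) by apply: lb_le_inf => //; exists T.
have gT : ginv G (s / SNR) <= T by apply: ge_inf => //; exists d.
rewrite (outage_lens (g := ginv G (s / SNR))).
- by rewrite /F_S_opt F_Gamma_optE// subKr.
- by rewrite dg gT.
- move=> x /andP[gx _]; have [y [y0 Gy] yx] := inf_lt (ex_intro _ T ST) gx.
  by rewrite -GsE; case: hG => _ Gni _ _; apply: le_trans Gy; apply: Gni => //; exact: ltW.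
- move=> x /andP[dx xg]; rewrite ltNge -GsE; apply/negP => Gx.
  have : ginv G (s / SNR) <= x.
    apply: ge_inf; first by exists d.
    by split => //; apply: le_trans dx; exact: ltW.
  by rewrite leNgt xg.
Qed.

(** Since [shat] is never below [d], even the best relay is in outage. *)
Lemma outage_above : (SNR%:E * G d <= s%:E)%E -> outage P rate rho = 1%E.
Proof.
move=> ds; apply/eqP; rewrite eq_le probability_le1//=.
rewrite -(probability_setT P); apply: outage_sub => // w _ _.
by apply: le_trans ds; apply: SNR_path_loss_le (shat_ge _); exact: ltW.
Qed.

End threshold.

End outage.

(** * Ergodic rate under Rayleigh and no fading *)

Section rayleigh.
Context {R : realType}.
Local Notation mu := (@lebesgue_measure R).

(* Lebesgue measure is recovered by gluing [pi^-1] times the push-forward of the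
   area by [sqmod], carried by [0, +oo[, to its own restriction to ]-oo, 0]. *)
Lemma area_sqmod_preimage (A : set (measurableTypeR R)) :
  measurable A -> A `<=` [set u | 0 < u] ->
  area (@sqmod R @^-1` A) = (pi%:E * mu A)%E.
Proof.
move=> mA A0.
have pi0 : 0 < pi^-1 :> R by rewrite invr_gt0 pi_gt0.
have msq : @measurable_fun _ _ (plane R) (measurableTypeR R) setT (@sqmod R).
  exact: measurable_sqmod.
have mneg : measurable (`]-oo, 0]%classic : set (measurableTypeR R)) by exact: measurable_itv.
have [m1 m1E] : exists m1 : {measure set (measurableTypeR R) -> \bar R},
    forall B, m1 B = (pi^-1%:E * area (@sqmod R @^-1` B))%E.
  unshelve eexists (mscale (NngNum (ltW pi0))
    (pushforward (mu \x mu)%E (@sqmod R : plane R -> measurableTypeR R))) => //.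
have m1D (x : R) : m1 `]-oo, x]%classic = (Num.max x 0)%:E.
  apply: (etrans (m1E _)); have [x0|x0] := leP 0 x.
    have := area_disc x0; rewrite -[_ @^-1` _]/[set z | sqmod z <= x] => ->.
    by rewrite -EFinM mulrA mulVf ?mul1r// gt_eqF// pi_gt0.
  rewrite (_ : _ @^-1` _ = set0); first by rewrite [area _](measure0 (mu \x mu)%E) mule0.
  by apply/seteqP; split => z //=; rewrite in_itv/= leNgt (lt_le_trans x0)// sqmod_ge0.
have m1I a b : a < b -> m1 `]a, b]%classic = (Num.max b 0 - Num.max a 0)%:E.
  move=> ab; have : m1 `]-oo, b]%classic = (m1 `]-oo, a]%classic + m1 `]a, b]%classic)%E.
    rewrite -measureU//.
    - congr (m1 _); apply/seteqP; split => x /=; rewrite !in_itv/=.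
        by move=> xb; have [xa|xa] := leP x a; [left|right].
      by move=> [xa|/andP[]//]; apply: le_trans xa (ltW ab).
    - apply/seteqP; split => x //=; rewrite !in_itv/= => -[xa /andP[ax _]].
      by move: xa; rewrite leNgt ax.
  rewrite !m1D; case: (m1 _) => [r| |]//.
  by rewrite -EFinD => -[->]; rewrite addrAC subrr add0r.
have addE B : measure_add m1 (mrestr mu mneg) B = (m1 B + mu (B `&` `]-oo, 0%R]))%E.
  exact: measure_addE.
have key B : measurable B -> mu B = measure_add m1 (mrestr mu mneg) B.
  apply: lebesgue_measure_unique => _ [[a b]] _ <-; apply: (etrans _ (esym (addE _))) => /=.
  have [ba|ab] := leP b a.
    by rewrite set_itv_ge ?bnd_simp -?leNgt// set0I !measure0 adde0.
  rewrite m1I// (_ : _ `&` _ = `]a, Num.min b 0]%classic); last first.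
    apply/seteqP; split => x /=; rewrite !in_itv/= le_min.
      by move=> [/andP[-> ->] ->].
    by move=> /and3P[-> -> ->].
  rewrite !lebesgue_measure_itv/= !lte_fin ab lt_min ab/=.
  have [b0|b0] := leP 0 b; have [a0|a0] := leP 0 a.
  - by rewrite adde0.
  - by rewrite -!EFinD; congr EFin; ring.
  - by exfalso; lra.
  - by rewrite -!EFinD; congr EFin; ring.
rewrite key// addE m1E (_ : _ `&` _ = set0); last first.
  apply/seteqP; split => x //= [/A0/=]; rewrite in_itv/= => x0.
  by rewrite leNgt x0.
by rewrite measure0 adde0 muleA -EFinM mulfV ?mul1e// gt_eqF// pi_gt0.
Qed.

(** * The law of |H|^2 under Rayleigh fading *)

Lemma normal_pdf_half x :
  normal_pdf 0 (Num.sqrt 2^-1) x = (Num.sqrt pi)^-1 * expR (- x ^+ 2) :> R.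
Proof.
have h0 : Num.sqrt 2^-1 != 0 :> R by rewrite sqrtr_eq0 -ltNge invr_gt0.
have hh : Num.sqrt 2^-1 ^+ 2 = 2^-1 :> R by rewrite sqr_sqrtr// invr_ge0.
rewrite normal_pdfE// /normal_peak /normal_fun hh subr0; congr (_^-1 * expR _).
  by congr Num.sqrt; rewrite -mulr_natl; field.
by rewrite -mulr_natl mulfV// divr1.
Qed.

(** The integral of the product density is a measure in [A] which, by Tonelli, has the right values
    on rectangles. *)
Lemma product_density d1 d2 (T1 : measurableType d1) (T2 : measurableType d2)
    (m1 : {sigma_finite_measure set T1 -> \bar R})
    (m2 : {sigma_finite_measure set T2 -> \bar R})
    (n1 : {sigma_finite_measure set T1 -> \bar R})
    (n2 : {sigma_finite_measure set T2 -> \bar R})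
    (f1 : T1 -> R) (f2 : T2 -> R) A :
  (forall x, 0 <= f1 x) -> (forall x, 0 <= f2 x) ->
  measurable_fun setT f1 -> measurable_fun setT f2 ->
  (forall B, measurable B -> n1 B = \int[m1]_(x in B) (f1 x)%:E)%E ->
  (forall B, measurable B -> n2 B = \int[m2]_(x in B) (f2 x)%:E)%E ->
  measurable A ->
  ((n1 \x n2) A = \int[m1 \x m2]_(z in A) (f1 z.1 * f2 z.2)%:E)%E.
Proof.
move=> f10 f20 mf1 mf2 n1E n2E mA.
pose f (z : T1 * T2) := (f1 z.1 * f2 z.2)%:E.
have mf : measurable_fun setT f.
  apply/measurable_EFinP; apply: measurable_funM.
    exact: (measurableT_comp mf1).
  exact: (measurableT_comp mf2).
have f0 z : (0 <= f z)%E by rewrite lee_fin mulr_ge0.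
have dens0 : (\int[m1 \x m2]_(z in set0) f z = 0)%E by rewrite integral_set0.
have dens_ge0 B : (0 <= \int[m1 \x m2]_(z in B) f z)%E by exact: integral_ge0.
have dens_add : semi_sigma_additive (fun B => \int[m1 \x m2]_(z in B) f z)%E.
  move=> /= F mF tF mUF; apply: cvg_toP.
    apply: ereal_nondecreasing_is_cvgn => m n mn.
    by apply: lee_sum_nneg_natr => // k _ _; exact: integral_ge0.
  by rewrite ge0_integral_bigcup//; exact: measurable_funTS.
pose dens : {measure set (T1 * T2) -> \bar R} :=
  HB.pack (fun B => \int[m1 \x m2]_(z in B) f z)%E
    (isMeasure.Build _ _ _ (fun B => \int[m1 \x m2]_(z in B) f z)%E dens0 dens_ge0 dens_add).
apply: (product_measure_unique (m' := dens)) => // B C mB mC.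
rewrite /dens/= integral_mkcond epatch_indic fubini_tonelli1//; last 2 first.
- apply: emeasurable_funM => //; apply/measurable_EFinP.
  by apply: measurable_indic; exact: measurableX.
- by move=> z; rewrite mule_ge0// lee_fin.
have mB1 : measurable_fun setT (fun x => (f1 x)%:E * (\1_B x)%:E)%E.
  by apply: emeasurable_funM; apply/measurable_EFinP => //; exact: measurable_indic.
have mC1 : measurable_fun setT (fun x => (f2 x)%:E * (\1_C x)%:E)%E.
  by apply: emeasurable_funM; apply/measurable_EFinP => //; exact: measurable_indic.
have fub x : fubini_F m2 (f \* (EFin \o \1_(B `*` C)))%E x =
    ((f1 x)%:E * (\1_B x)%:E * n2 C)%E.
  rewrite n2E// [in RHS]integral_mkcond epatch_indic -ge0_integralZl//.
  - apply: eq_integral => y _; rewrite /f/= -!EFinM; congr EFin.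
    by rewrite !indicE in_setX/= -mulnb natrM; ring.
  - by move=> y _; rewrite mule_ge0// lee_fin.
  - by rewrite mule_ge0// lee_fin.
under eq_integral do rewrite fub.
rewrite ge0_integralZr//; last by move=> x _; rewrite mule_ge0// lee_fin.
by rewrite [in RHS]n1E// [in RHS]integral_mkcond epatch_indic.
Qed.

(** The two normal densities multiply into a function of [sqmod] alone, so that the law of |H|^2 can
    be read off from [area_sqmod_preimage]. *)
Lemma rayleigh_density (nu : probability (plane R) R) A :
  rayleigh_fading nu -> measurable A ->
  nu A = (\int[area (R := R)]_(z in A) (pi^-1 * expR (- sqmod z))%:E)%E.
Proof.
move=> hnu mA; rewrite hnu//.
rewrite (@product_density _ _ _ _ mu mu _ _
  (normal_pdf 0 (Num.sqrt 2^-1)) (normal_pdf 0 (Num.sqrt 2^-1)))//.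
- apply: eq_integral => z _; rewrite !normal_pdf_half; congr EFin.
  rewrite mulrACA -expRD -invfM -expr2 sqr_sqrtr ?pi_ge0//.
  by congr (_ * expR _); rewrite /sqmod; ring.
- by move=> x; exact: normal_pdf_ge0.
- by move=> x; exact: normal_pdf_ge0.
- exact: measurable_normal_pdf.
- exact: measurable_normal_pdf.
Qed.

Lemma rayleigh_tail (nu : probability (plane R) R) t : rayleigh_fading nu -> 0 <= t ->
  nu [set z | t < sqmod z] = (expR (- t))%:E.
Proof.
move=> hnu t0.
have mS : measurable (`]t, +oo[%classic : set (measurableTypeR R)) by exact: measurable_itv.
have msq : @measurable_fun _ _ (plane R) (measurableTypeR R) setT (@sqmod R).
  exact: measurable_sqmod.
have mset : measurable [set z : plane R | t < sqmod z].
  have := msq measurableT _ mS; rewrite setTI; congr measurable.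
  by apply/seteqP; split => z /=; rewrite in_itv/= andbT.
pose h (u : R) := pi^-1 * expR (- u).
have ch : continuous h.
  move=> u; apply: cvgM; first exact: cvg_cst.
  apply: (@continuous_comp _ _ _ (fun u : R => - u) (@expR R)).
    exact: (@continuousN _ R^o).
  exact: continuous_expR.
have mh : measurable_fun setT h by exact: continuous_measurable_fun.
have h0 u : 0 <= h u by rewrite mulr_ge0 ?expR_ge0// invr_ge0 pi_ge0.
rewrite rayleigh_density//.
transitivity (\int[pushforward (area (R := R))
    (@sqmod R : plane R -> measurableTypeR R)]_(u in `]t, +oo[) (h u)%:E)%E.
  rewrite ge0_integral_pushforward//.
  - rewrite (_ : [set z | _] = @sqmod R @^-1` `]t, +oo[)//.
    by apply/seteqP; split => z /=; rewrite in_itv/= andbT.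
  - by apply/measurable_EFinP; exact: measurable_funTS.
  - by move=> u _; rewrite lee_fin.
have pi0 : 0 <= pi :> R by exact: pi_ge0.
(* As [0 <= t], only sets of positive reals occur, as [area_sqmod_preimage] demands. *)
rewrite (@eq_measure_integral _ _ _ _ (mscale (NngNum pi0) mu)); last first.
  move=> A mA At; apply: (area_sqmod_preimage mA) => x /At.
  by rewrite /= in_itv/= andbT; exact: le_lt_trans.
have mhS : measurable_fun (`]t, +oo[%classic : set (measurableTypeR R)) (EFin \o h).
  by apply/measurable_EFinP; exact: measurable_funTS.
rewrite ge0_integral_mscale//; last by move=> u _; rewrite lee_fin.
rewrite integral_itv_obnd_cbnd//.
rewrite (@ge0_continuous_FTC2y _ _ (fun u => - h u) _ 0).
- rewrite -EFinB -EFinM /=; congr EFin; rewrite /h.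
  by rewrite sub0r opprK mulrA mulfV ?mul1r// gt_eqF// pi_gt0.
- by move=> u _; exact: h0.
- exact: continuous_subspaceT.
- rewrite -oppr0; apply: cvgN; rewrite -(mulr0 pi^-1).
  by apply: cvgM; [exact: cvg_cst|exact: cvgr_expR].
- by move=> u _; exact: ex_derive.
- by apply: cvg_at_right_filter; apply: cvgN; exact: ch.
- move=> u _; rewrite derive1E /h; apply: derive_val.
  have de : is_derive u (1 : R) (fun u => expR (- u)) (- expR (- u)).
    apply: (is_derive_eq (is_derive1_comp (is_derive_expR _) (is_deriveNid u 1))).
    by rewrite mulrN1.
  apply: (is_derive_eq (is_deriveN (is_deriveZ pi^-1 de))).
  by rewrite /GRing.scale/= mulrN opprK.
Qed.

(** * Monotonicity and growth of the ergodic rate *)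

Lemma log2e_EFin (x : R) : 0 <= x -> log2e (1 + x%:E)%E = (ln (1 + x) / ln 2)%:E.
Proof. by move=> x0; rewrite /log2e -EFinD lne_EFin ?EFinM// ltr_pwDl. Qed.

Lemma ergodic_rate_fin (nu : probability (plane R) R) (x : R) : 0 <= x ->
  ergodic_rate nu x%:E = (\int[nu]_z (ln (1 + sqmod z * x) / ln 2)%:E)%E.
Proof.
move=> x0; apply: eq_integral => z _.
by rewrite -EFinM log2e_EFin// mulr_ge0// sqmod_ge0.
Qed.

Lemma measurable_log_sqmod (x : R) : 0 <= x ->
  measurable_fun [set: plane R] (fun z => ln (1 + sqmod z * x) / ln 2).
Proof.
move=> x0; apply: measurable_funM; last exact: measurable_cst.
apply: (measurableT_comp (@measurable_ln R)); apply: measurable_funD => //.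
by apply: measurable_funM; [exact: measurable_sqmod|exact: measurable_cst].
Qed.

Lemma log_sqmod_ge0 (x : R) (z : plane R) : 0 <= x -> 0 <= ln (1 + sqmod z * x) / ln 2.
Proof.
by move=> x0; rewrite divr_ge0 ?(ltW ln2_gt0)// ln_ge0// lerDl mulr_ge0// sqmod_ge0.
Qed.

(** With q = |H|^2, (1 + q y)(1 + x) - (1 + q x)(1 + y) = (y - x)(q - 1), so the integrand gains at
    least the stated logarithm where q > 1, and it does not decrease elsewhere. This yields strict
    monotonicity and, from x = 0, unbounded growth. *)
Lemma ergodic_rate_gap (nu : probability (plane R) R) (x y : R) : 0 <= x -> x <= y ->
  (ergodic_rate nu x%:E + ((ln (1 + y) - ln (1 + x)) / ln 2)%:E * nu [set z | 1 < sqmod z]%R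
   <= ergodic_rate nu y%:E)%E.
Proof.
move=> x0 xy; have y0 := le_trans x0 xy.
have mS : measurable [set z : plane R | 1 < sqmod z].
  rewrite -[X in measurable X]setTI.
  have -> : [set z : plane R | 1 < sqmod z] = @sqmod R @^-1` `]1, +oo[.
    by apply/seteqP; split => z /=; rewrite in_itv/= andbT.
  by apply: measurable_sqmod => //; exact: measurable_itv.
have l2 := @ln2_gt0 R.
set k := (_ - _) / _; have k0 : 0 <= k.
  by rewrite divr_ge0 ?(ltW l2)// subr_ge0 ler_ln ?posrE; lra.
rewrite !ergodic_rate_fin// -(setIT [set z | 1 < sqmod z]) -integral_indic//.
rewrite -ge0_integralZl//; last exact/measurable_EFinP/measurable_indic.
rewrite -ge0_integralD//.
- apply: ge0_le_integral => //.
  + by move=> z _; rewrite adde_ge0 ?mule_ge0 ?lee_fin// log_sqmod_ge0.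
  + apply: emeasurable_funD; first by apply/measurable_EFinP; exact: measurable_log_sqmod.
    by apply: emeasurable_funM => //; apply/measurable_EFinP; exact: measurable_indic.
  + by apply/measurable_EFinP; exact: measurable_log_sqmod.
  + move=> z _; rewrite -EFinM -EFinD lee_fin indicE.
    have q0 := sqmod_ge0 z; have xq0 := mulr_ge0 q0 x0; have yq0 := mulr_ge0 q0 y0.
    have [|] := boolP (z \in _); last first.
      rewrite mulr0 addr0 => _; rewrite ler_pM2r ?invr_gt0// ler_ln ?posrE; [|lra|lra].
      by rewrite lerD2l ler_wpM2l.
    rewrite inE/= => q1; rewrite mulr1 /k -mulrDl ler_pM2r ?invr_gt0// addrA lerBlDr.
    rewrite -!lnM ?posrE; [|lra..]; rewrite ler_ln ?posrE; [|rewrite mulr_gt0; lra..].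
    have h : 0 <= (y - x) * (sqmod z - 1) by apply: mulr_ge0; lra.
    by rewrite -subr_ge0 (_ : _ - _ = (y - x) * (sqmod z - 1)); last by ring.
- by move=> z _; rewrite lee_fin log_sqmod_ge0.
- by apply/measurable_EFinP; exact: measurable_log_sqmod.
- by move=> z _; rewrite mule_ge0// lee_fin.
- by apply: emeasurable_funM => //; apply/measurable_EFinP; exact: measurable_indic.
Qed.

(** Pointwise, (1 + q y) / (1 + q x) <= y / x for every q >= 0. It serves to prove continuity. *)
Lemma ergodic_rate_upper (nu : probability (plane R) R) (x y : R) : 0 < x -> x <= y ->
  (ergodic_rate nu y%:E <= ergodic_rate nu x%:E + ((ln y - ln x) / ln 2)%:E)%E.
Proof.
move=> x0 xy; have y0 := lt_le_trans x0 xy; have l2 := @ln2_gt0 R.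
set k := (_ - _) / _; have k0 : 0 <= k.
  by rewrite divr_ge0 ?(ltW l2)// subr_ge0 ler_ln ?posrE.
have -> : k%:E = (\int[nu]_(z in [set: plane R]) cst k%:E z)%E.
  by rewrite integral_cst// [X in (_ * X)%E]probability_setT mule1.
rewrite (ergodic_rate_fin _ (ltW x0)) (ergodic_rate_fin _ (ltW y0)) -ge0_integralD//.
- apply: ge0_le_integral => //.
  + by move=> z _; rewrite lee_fin log_sqmod_ge0// ltW.
  + by apply/measurable_EFinP; apply: measurable_log_sqmod; exact: ltW.
  + apply: emeasurable_funD; last exact: measurable_cst.
    by apply/measurable_EFinP; apply: measurable_log_sqmod; exact: ltW.
  + move=> z _; rewrite -EFinD lee_fin.
    have q0 := sqmod_ge0 z; have xq0 := mulr_ge0 q0 (ltW x0); have yq0 := mulr_ge0 q0 (ltW y0).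
    rewrite /k -mulrDl ler_pM2r ?invr_gt0// addrA lerBrDr.
    rewrite -!lnM ?posrE; [|lra..]; rewrite ler_ln ?posrE; [|rewrite mulr_gt0; lra..].
    by nra.
- by move=> z _; rewrite lee_fin log_sqmod_ge0// ltW.
- by apply/measurable_EFinP; apply: measurable_log_sqmod; exact: ltW.
Qed.

Lemma ergodic_rate_mono (nu : probability (plane R) R) :
  (0 < nu [set z | (1 < sqmod z)%R])%E ->
  (forall x : R, 0 <= x -> (ergodic_rate nu x%:E < +oo)%E) ->
  forall x y : R, 0 <= x -> x < y -> (ergodic_rate nu x%:E < ergodic_rate nu y%:E)%E.
Proof.
move=> nu0 fin x y x0 xy; apply: lt_le_trans (ergodic_rate_gap nu x0 (ltW xy)).
rewrite lteDl ?ge0_fin_numE ?fin ?ergodic_rate_ge0//.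
rewrite mule_gt0// lte_fin divr_gt0 ?ln2_gt0// subr_gt0 ltr_ln ?posrE; lra.
Qed.

Lemma no_fading_rate (nu : probability (plane R) R) (x : \bar R) :
  no_fading nu -> (0 <= x)%E -> ergodic_rate nu x = log2e (1 + x).
Proof.
move=> nf x0; have m1 : measurable [set z : plane R | sqmod z = 1].
  rewrite -[X in measurable X]setTI -[X in _ `&` X]/(@sqmod R @^-1` [set 1]).
  exact: measurable_sqmod.
have nf' : nu (~` [set z | sqmod z = 1]) = 0%E.
  by rewrite probability_setC// nf subee.
have -> : log2e (1 + x)%E = (\int[nu]_(z in [set: plane R]) cst (log2e (1 + x)) z)%E.
  by rewrite integral_cst// [X in (_ * X)%E]probability_setT mule1.
apply: ae_eq_integral => //; first exact: measurable_rate_integrand.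
exists (~` [set z | sqmod z = 1]); split => //; first exact: measurableC.
by move=> z /= h e; apply: h => _; rewrite e mul1e.
Qed.

(** * The exponential integral and the Rayleigh rate *)

Lemma is_derive_exp_scale (a x : R) :
  is_derive x (1 : R) (fun x => expR (- (x * a))) (- (a * expR (- (x * a)))).
Proof.
have da : is_derive x (1 : R) (fun x => - (x * a)) (- a).
  apply: (is_derive_eq (is_deriveN (is_deriveM (is_derive_id x 1) (is_derive_cst a x 1)))).
  by rewrite /GRing.scale/= mulr0 add0r mulr1.
apply: (is_derive_eq (is_derive1_comp (is_derive_expR _) da)).
by rewrite mulrN mulrC.
Qed.

Lemma continuous_exp_scale (a : R) : continuous (fun x : R => expR (- (x * a))).
Proof.
move=> x; apply: (@continuous_comp _ _ _ (fun x : R => - (x * a)) (@expR R)).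
  by apply: cvgN; apply: cvgM; [exact: cvg_id|exact: cvg_cst].
exact: continuous_expR.
Qed.

Lemma cvg_exp_scale (a : R) : 0 < a -> expR (- (x * a)) @[x --> +oo] --> 0.
Proof.
move=> a0; rewrite (_ : (fun x => expR (- (x * a))) =
    (fun z => expR (- z)) \o (fun x => x * a))//.
apply: (@cvg_comp _ _ _ _ _ _ (pinfty_nbhs R)); last exact: cvgr_expR.
exact: gt0_cvgMly.
Qed.

Lemma integral_exp_scale (a : R) : 0 < a ->
  (\int[mu]_(x in `[1%R, +oo[) (expR (- (x * a)))%:E = (a^-1 * expR (- a))%:E)%E.
Proof.
move=> a0; rewrite (@ge0_continuous_FTC2y _ _ (fun x => - (a^-1 * expR (- (x * a)))) _ 0).
- by rewrite mul1r -EFinB opprK add0r.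
- by move=> x _; exact: expR_ge0.
- by apply: continuous_subspaceT; exact: continuous_exp_scale.
- rewrite -oppr0; apply: cvgN; rewrite -(mulr0 a^-1).
  by apply: cvgM; [exact: cvg_cst|exact: cvg_exp_scale].
- move=> x _; have := is_derive_exp_scale a x => ?; exact: ex_derive.
- apply: cvg_at_right_filter; apply: cvgN; apply: cvgM; first exact: cvg_cst.
  exact: continuous_exp_scale.
- move=> x _; rewrite derive1E; apply: derive_val.
  apply: (is_derive_eq (is_deriveN (is_deriveZ a^-1 (is_derive_exp_scale a x)))).
  by rewrite /GRing.scale/=; field; rewrite gt_eqF.
Qed.

Lemma measurable_exp_inv (a : R) :
  measurable_fun (`[1, +oo[%classic : set (measurableTypeR R))
    (fun x => (expR (- (x * a)) / x)%:E).
Proof.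
apply/measurable_EFinP; apply: measurable_funM.
  apply: measurable_funTS; apply: continuous_measurable_fun.
  exact: continuous_exp_scale.
apply: subspace_continuous_measurable_fun => //.
apply: continuous_in_subspaceT => x; rewrite inE/= in_itv/= andbT => x1.
by apply: inv_continuous; lra.
Qed.

(** On [1, +oo[ the factor 1 / x is at most 1. The resulting finiteness matters because [E1] is a
    real-valued integral, which represents the extended one only when that is finite. *)
Lemma integral_E1 (a : R) : 0 < a ->
  (\int[mu]_(x in `[1%R, +oo[) (expR (- (x * a)) / x)%:E = (E1 a)%:E)%E /\
  E1 a <= a^-1 * expR (- a).
Proof.
move=> a0; have mE := measurable_exp_inv a.
have I0 : (0 <= \int[mu]_(x in `[1%R, +oo[) (expR (- (x * a)) / x)%:E)%E.
  apply: integral_ge0 => x /=; rewrite in_itv/= andbT => x1.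
  by rewrite lee_fin divr_ge0 ?expR_ge0//; lra.
have Ile : (\int[mu]_(x in `[1%R, +oo[) (expR (- (x * a)) / x)%:E <=
    (a^-1 * expR (- a))%:E)%E.
  rewrite -integral_exp_scale//; apply: ge0_le_integral => //.
  - move=> x /=; rewrite in_itv/= andbT => x1.
    by rewrite lee_fin divr_ge0 ?expR_ge0//; lra.
  - apply/measurable_EFinP; apply: measurable_funTS; apply: continuous_measurable_fun.
    exact: continuous_exp_scale.
  - move=> x /=; rewrite in_itv/= andbT => x1; rewrite lee_fin.
    by rewrite ler_piMr ?expR_ge0// invf_le1//; lra.
have Ifin : (\int[mu]_(x in `[1%R, +oo[) (expR (- (x * a)) / x)%:E)%E \is a fin_num.
  by rewrite ge0_fin_numE//; apply: le_lt_trans Ile _; exact: ltry.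
by split; [rewrite /E1 /Rintegral fineK|rewrite -lee_fin /E1 /Rintegral fineK].
Qed.

Lemma integral_log_tail (a : R) : 0 < a ->
  (\int[mu]_(r in `[0%R, +oo[) (expR (- ((expR r - 1) * a)))%:E = (expR a * E1 a)%:E)%E.
Proof.
move=> a0.
have dln (x : R) : 0 < x -> ((@ln R)^`())%classic x = x^-1.
  by move=> x0; rewrite derive1E; apply: derive_val; exact: is_derive1_ln.
(* With r = ln t the bound t = 1 becomes r = 0, and the derivative 1 / t supplies the denominator in
   [E1]. *)
have := @increasing_ge0_integration_by_substitutiony R (@ln R)
  (fun r => expR (- ((expR r - 1) * a))) 1.
rewrite ln1 => -> //.
- have [EE _] := integral_E1 a0.
  rewrite EFinM -EE -ge0_integralZl//.
  + apply: eq_integral => x; rewrite inE/= in_itv/= andbT => x1 /=.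
    have x0 : 0 < x by lra.
    rewrite -EFinM; congr EFin.
    rewrite -[LHS]/(expR (- ((expR (ln x) - 1) * a)) * (@ln R)^`()%classic x).
    rewrite dln// lnK ?posrE// mulrA -expRD; congr (expR _ * _); ring.
  + exact: measurable_exp_inv.
  + move=> x /=; rewrite in_itv/= andbT => x1.
    by rewrite lee_fin divr_ge0 ?expR_ge0//; lra.
- move=> x y; rewrite !in_itv/= !andbT => x1 y1 xy.
  by rewrite ltr_ln ?posrE//; lra.
- move=> x; rewrite in_itv/= andbT => x1; have x0 : 0 < x by lra.
  rewrite /continuous_at dln//; apply: cvg_trans; last exact: (inv_continuous (lt0r_neq0 x0)).
  by apply: near_eq_cvg; near=> y; rewrite dln//; near: y; exact: lt_nbhsr.
- apply/cvg_ex; exists 1^-1; apply: cvg_trans; last first.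
    by apply: cvg_at_right_filter; apply: inv_continuous.
  apply: near_eq_cvg; near=> y; rewrite dln//; apply: lt_trans ltr01 _.
  by near: y; exact: nbhs_right_gt.
- apply/cvg_ex; exists 0; apply: (@cvg_trans _ (x^-1 @[x --> +oo])).
    by apply: near_eq_cvg; near=> y; rewrite /= dln.
  apply/cvgr0Pnorm_lt => e e0; near=> x.
  have xe : e^-1 < x by near: x; apply: nbhs_pinfty_gt; exact: num_real.
  have x0 : 0 < x by apply: lt_trans xe; rewrite invr_gt0.
  by rewrite gtr0_norm ?invr_gt0// invf_plt.
- split.
    move=> x; rewrite in_itv/= andbT => x1.
    by have := is_derive1_ln (lt_trans ltr01 x1) => ?; exact: ex_derive.
  by apply: cvg_at_right_filter; exact: continuous_ln.
- apply/cvgryPge => A; near=> x.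
  have Ax : expR A <= x by near: x; apply: nbhs_pinfty_ge; exact: num_real.
  by rewrite -[leLHS]expRK ler_ln ?posrE ?expR_gt0// (lt_le_trans _ Ax) ?expR_gt0.
- apply: continuous_subspaceT => x.
  apply: (@continuous_comp _ _ _ (fun r : R => - ((expR r - 1) * a)) (@expR R));
    last exact: continuous_expR.
  apply: cvgN; apply: cvgM; last exact: cvg_cst.
  by apply: cvgB; [exact: continuous_expR|exact: cvg_cst].
Unshelve. all: by end_near. Qed.

(** The event ln (1 + |H|^2 s) > r is |H|^2 > (e^r - 1) / s, of probability exp (- (e^r - 1) / s):
    the integrand of [integral_log_tail] at a = 1 / s. *)
Lemma rayleigh_rate (nu : probability (plane R) R) (s : R) : rayleigh_fading nu -> 0 < s ->
  ergodic_rate nu s%:E = (expR (1 / s) * E1 (1 / s) / ln 2)%:E.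
Proof.
move=> hnu s0; have l2 := @ln2_gt0 R.
have mX : measurable_fun [set: plane R] (fun z => ln (1 + sqmod z * s)).
  apply: (measurableT_comp (@measurable_ln R)); apply: measurable_funD => //.
  by apply: measurable_funM; [exact: measurable_sqmod|exact: measurable_cst].
pose X : {RV nu >-> R} := mfun_Sub (mem_set mX).
have X0 z : 0 <= X z by rewrite /= ln_ge0// lerDl mulr_ge0 ?sqmod_ge0// ltW.
have XE : (\int[nu]_z (X z)%:E = (expR (1 / s) * E1 (1 / s))%:E)%E.
  have := ge0_expectation_ccdf X0; rewrite expectation_def => ->.
  rewrite -integral_log_tail ?divr_gt0//; apply: eq_integral => r.
  rewrite inE/= in_itv/= andbT => r0.
  rewrite /ccdf /distribution /pushforward.
  rewrite -(rayleigh_tail hnu); last first.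
    by rewrite mulr_ge0 ?divr_ge0 ?(ltW s0)// subr_ge0 -expR0 ler_expR.
  have XrE z : (r < X z) = ((expR r - 1) * (1 / s) < sqmod z).
    have q0 := mulr_ge0 (sqmod_ge0 z) (ltW s0).
    rewrite -[in LHS](expRK r) ltr_ln ?posrE ?expR_gt0//; last by lra.
    by rewrite mulrA mulr1 ltr_pdivrMr// ltrBlDl.
  by congr (nu _); apply/seteqP; split => z; rewrite /= in_itv/= andbT XrE.
rewrite ergodic_rate_fin ?(ltW s0)//.
under eq_integral do rewrite EFinM.
rewrite ge0_integralZr//; first by rewrite XE -EFinM.
- exact/measurable_EFinP.
- by move=> z _; rewrite lee_fin; exact: X0.
- by rewrite lee_fin invr_ge0 ltW.
Qed.

Lemma rayleigh_rate_lty (nu : probability (plane R) R) (x : R) : rayleigh_fading nu ->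
  0 <= x -> (ergodic_rate nu x%:E < +oo)%E.
Proof.
(* The closed form is for positive arguments; at 0 the rate is bounded by its value at 1. *)
move=> hnu; rewrite le_eqVlt => /predU1P[<-|x0]; last by rewrite rayleigh_rate// ltry.
apply: le_lt_trans (le_ergodic_rate nu (lexx 0%E) (_ : (0 <= 1%:E)%E)) _.
  by rewrite lee_fin.
by rewrite rayleigh_rate// ltry.
Qed.

Lemma rayleigh_rate_mono (nu : probability (plane R) R) : rayleigh_fading nu ->
  forall x y : R, 0 <= x -> x < y -> (ergodic_rate nu x%:E < ergodic_rate nu y%:E)%E.
Proof.
move=> hnu; apply: ergodic_rate_mono; last by move=> x; exact: rayleigh_rate_lty.
by rewrite rayleigh_tail// lte_fin expR_gt0.
Qed.

Lemma rayleigh_ergodic_snr (nu : probability (plane R) R) (rho : R) :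
  rayleigh_fading nu -> 0 < rho -> exists s, unique (ergodic_snr rho) s.
Proof.
move=> hnu rho0; have l2 := @ln2_gt0 R.
pose h s := expR (1 / s) * E1 (1 / s) / ln 2 : R.
have hE s : 0 < s -> ergodic_rate nu s%:E = (h s)%:E by exact: rayleigh_rate.
have hmono x y : 0 < x -> x < y -> h x < h y.
  move=> x0 xy; have y0 := lt_trans x0 xy; rewrite -lte_fin -(hE x x0) -(hE y y0).
  by apply: rayleigh_rate_mono => //; exact: ltW.
have snrE s : ergodic_snr rho s <-> 0 < s /\ h s = 2 * rho.
  rewrite /ergodic_snr /h; split=> -[s0 e]; split => //.
    by rewrite -e; field; rewrite gt_eqF.
  have -> : (2 * ln 2)^-1 * expR (1 / s) * E1 (1 / s) = (expR (1 / s) * E1 (1 / s) / ln 2) / 2.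
    by field; rewrite gt_eqF.
  by rewrite e mulrAC mulfV ?mul1r.
have hle s : 0 < s -> h s <= s / ln 2.
  move=> s0; rewrite ler_pM2r ?invr_gt0//.
  have s1 : 0 < 1 / s by rewrite divr_gt0.
  have [_ E1le] := integral_E1 s1; apply: le_trans (ler_wpM2l (expR_ge0 _) E1le) _.
  by rewrite mulrCA -expRD subrr expR0 mulr1 invf_div divr1.
(* The constant e^-1 is the probability of |H|^2 > 1, from the gap estimate started at 0. *)
have hge s : 0 < s -> (ln (1 + s) / ln 2) * expR (-1) <= h s.
  move=> s0; rewrite -lee_fin -(hE s s0).
  have := ergodic_rate_gap nu (lexx 0) (ltW s0).
  rewrite rayleigh_tail// addr0 ln1 subr0; apply: le_trans.
  by rewrite EFinM leeDr// ergodic_rate_ge0.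
have hlip x y : 0 < x -> x <= y -> h y - h x <= (ln y - ln x) / ln 2.
  move=> x0 xy; have := ergodic_rate_upper nu x0 xy.
  by rewrite (hE x x0) (hE y (lt_le_trans x0 xy)) -EFinD lee_fin lerBlDl.
clearbody h.
(* The bound [hle] gives h a <= rho, and [b] is chosen so that e^-1 log2 b = 2 rho, whence [hge]
   gives h b >= 2 rho. *)
pose a := rho * ln 2; pose b := expR (2 * rho * ln 2 * expR 1).
have a0 : 0 < a by rewrite mulr_gt0.
have ha : h a <= 2 * rho.
  by apply: le_trans (hle a a0) _; rewrite /a mulfK ?gt_eqF//; lra.
have b0 : 0 < b by exact: expR_gt0.
have hb : 2 * rho <= h b.
  apply: le_trans (hge b b0).
  have -> : 2 * rho = ln b / ln 2 * expR (-1).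
    rewrite /b expRK expRN; field.
    by rewrite !gt_eqF ?expR_gt0.
  rewrite ler_pM2r ?expR_gt0// ler_pM2r ?invr_gt0// ler_ln ?posrE//; lra.
have ab : a <= b.
  by rewrite leNgt; apply/negP => /(hmono b a b0); lra.
have hdist x y : 0 < y -> y <= x -> `|h x - h y| <= `|ln x - ln y| / ln 2.
  move=> y0 yx; rewrite !ger0_norm ?hlip// subr_ge0.
    by rewrite ler_ln ?posrE// (lt_le_trans y0).
  by move: yx; rewrite le_eqVlt => /predU1P[->//|yx]; apply/ltW/hmono.
(* By [hdist], increments of [h] are controlled by those of ln, so [h] inherits its continuity. *)
have ch x : 0 < x -> {for x, continuous h}.
  move=> x0; apply/cvgrPdist_lt => e e0; near=> y.
  have y0 : 0 < y by near: y; exact: lt_nbhsr.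
  have lxy : `|ln x - ln y| < e * ln 2.
    near: y; have /cvgrPdist_lt := continuous_ln x0; apply.
    by rewrite mulr_gt0.
  apply: (@le_lt_trans _ _ (`|ln x - ln y| / ln 2)); last by rewrite ltr_pdivrMr.
  have [xy|/ltW yx] := leP x y; last exact: hdist.
  by rewrite distrC [X in X / _]distrC; exact: hdist.
have [c] : exists2 c, c \in `[a, b] & h c = 2 * rho.
  apply: IVT => //.
    apply: continuous_in_subspaceT => x; rewrite inE/= in_itv/= => /andP[ax _].
    by apply: ch; exact: lt_le_trans ax.
  by rewrite ge_min le_max ha hb orbT.
rewrite in_itv/= => /andP[ac _] hc; have c0 := lt_le_trans a0 ac.
exists c; split=> [|c' /snrE[c'0 hc']]; first by apply/snrE.
have [cc|cc|//] := ltgtP c c'.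
- by have := hmono _ _ c0 cc; rewrite hc hc' ltxx.
- by have := hmono _ _ c'0 cc; rewrite hc hc' ltxx.
Unshelve. all: by end_near. Qed.

End rayleigh.

(** * The outage probability in the three regimes, without fading and under Rayleigh fading *)

Theorem theorem7 (R : realType) (disp : measure_display)
  (Omega : measurableType disp) (P : probability Omega R)
  (lambda d SNR rho T : R) (xs xd : plane R) (G : R -> \bar R)
  (Phi : Omega -> set (plane R))
  (nu : probability (plane R) R) (Hsr Hrd : {RV P >-> plane R})
  (Xstar : Omega -> plane R) (rate : Omega -> \bar R) :
  0 < lambda -> 0 < d -> 0 < SNR -> 0 < rho -> d <= T ->
  eucl_dist xs xd = 2 * d ->
  path_loss G ->
  poisson_process P Phi lambda ->
  (forall A, measurable A -> distribution P Hsr A = nu A) ->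
  (forall A, measurable A -> distribution P Hrd A = nu A) ->
  pp_independent P Phi Hsr -> pp_independent P Phi Hrd ->
  fb_selection Phi xs xd T Xstar ->
  fb_rate P Phi xs xd T SNR G Hsr Hrd Xstar rate ->
  (no_fading nu ->
    let cap := fun x => (2^-1%:E * log2e (1 + SNR%:E * G x))%E in
    [/\ (rho%:E <= cap T)%E ->
          (rho%:E = cap T -> forall x, d <= x < T -> (G T < G x)%E) ->
          outage P rate rho = (expR (- mu_fb d lambda T))%:E,
        (cap T < rho%:E)%E -> (rho%:E < cap d)%E ->
          outage P rate rho = (F_S_opt d lambda SNR G (2 `^ (2 * rho) - 1))%:E &
        (cap d <= rho%:E)%E -> outage P rate rho = 1%E]) /\
  (rayleigh_fading nu ->
    exists2 s : R, unique (ergodic_snr rho) s &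
    [/\ (s%:E <= SNR%:E * G T)%E ->
          (s%:E = (SNR%:E * G T)%E -> forall x, d <= x < T -> (G T < G x)%E) ->
          outage P rate rho = (expR (- mu_fb d lambda T))%:E,
        (SNR%:E * G T < s%:E)%E -> (s%:E < SNR%:E * G d)%E ->
          outage P rate rho = (F_S_opt d lambda SNR G s)%:E &
        (SNR%:E * G d <= s%:E)%E -> outage P rate rho = 1%E]).
Proof.
move=> lambda0 d0 SNR0 rho0 dT dist_sd hG hPhi lsr lrd isr ird sel fb.
have mrate := measurable_fb_rate d0 dT dist_sd hPhi fb.
have rateE := fb_rate_ae SNR0 hG hPhi lsr lrd isr ird sel fb.
split=> [nf cap|ray].
- set s := 2 `^ (2 * rho) - 1; have l2 := @ln2_gt0 R.
  have s0 : 0 <= s.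
    rewrite /s /powR gt_eqF// subr_ge0 -[leLHS]expR0 ler_expR mulr_ge0 ?(ltW l2)//.
    by rewrite mulr_ge0 ?(ltW rho0).
  (* Here |H|^2 > 1 has probability 0, so strict monotonicity comes from the logarithm and not from
     [ergodic_rate_gap]. *)
  have rate_mono x y : 0 <= x -> x < y -> (ergodic_rate nu x%:E < ergodic_rate nu y%:E)%E.
    move=> x0 xy; have y0 := le_trans x0 (ltW xy).
    rewrite !no_fading_rate// !log2e_EFin// lte_fin ltr_pM2r ?invr_gt0//.
    by rewrite ltr_ln ?posrE ?ltrD2l// ltr_pwDl.
  have rate_s : (2^-1%:E * ergodic_rate nu s%:E = rho%:E)%E.
    rewrite no_fading_rate// log2e_EFin// /s addrC subrK ln_powR -EFinM; congr EFin.
    by field; rewrite gt_eqF.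
  have capE x : d <= x -> cap x = (2^-1%:E * ergodic_rate nu (SNR%:E * G x))%E.
    move=> dx; rewrite /cap no_fading_rate//; case: hG => G0 _ _ _.
    by rewrite mule_ge0 ?lee_fin ?(ltW SNR0)// G0// (le_trans _ dx)// ltW.
  have cap_le x : d <= x -> (cap x <= rho%:E)%E = (SNR%:E * G x <= s%:E)%E.
    by move=> dx; rewrite capE// (half_ergodic_rate_le d0 SNR0 hG s0 rate_mono rate_s).
  have cap_ge x : d <= x -> (rho%:E <= cap x)%E = (s%:E <= SNR%:E * G x)%E.
    by move=> dx; rewrite capE// (half_ergodic_rate_ge d0 SNR0 hG s0 rate_mono rate_s).
  split.
  + rewrite cap_ge// => sT strict.
    apply: (outage_below d0 SNR0 dT dist_sd hG hPhi rho0 s0 rate_mono rate_s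
      mrate sel rateE) => // e.
    (* Equality of SNRs at [T] gives equality of rates through the two comparisons. *)
    by apply: strict; apply/eqP; rewrite eq_le cap_ge// cap_le// e lexx.
  + rewrite ltNge cap_ge// -ltNge => Ts; rewrite ltNge cap_le// -ltNge => sd.
    exact: (outage_between d0 SNR0 dT dist_sd hG hPhi rho0 s0 rate_mono rate_s mrate sel rateE).
  + rewrite cap_le//.
    exact: (outage_above d0 SNR0 dist_sd hG rho0 s0 rate_mono rate_s mrate rateE).
- have [s us] := rayleigh_ergodic_snr ray rho0; exists s => //.
  case: us => -[s0 es] _; have s0' := ltW s0.
  have rate_mono := rayleigh_rate_mono ray.
  have rate_s : (2^-1%:E * ergodic_rate nu s%:E = rho%:E)%E.
    rewrite rayleigh_rate// -EFinM -es; congr EFin.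
    by field; rewrite gt_eqF// ln2_gt0.
  split.
  + exact: (outage_below d0 SNR0 dT dist_sd hG hPhi rho0 s0' rate_mono rate_s mrate sel rateE).
  + exact: (outage_between d0 SNR0 dT dist_sd hG hPhi rho0 s0' rate_mono rate_s mrate sel rateE).
  + exact: (outage_above d0 SNR0 dist_sd hG rho0 s0' rate_mono rate_s mrate rateE).
Qed.
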